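(* Let $\alpha,\beta,\theta\in(0,\pi)$, let $V$ be a flat-foldable degree-4 vertex with sector angles $\pi-\alpha,\ \pi-\beta,\ \alpha,\ \beta$ in counterclockwise order, and let $DL(V,\theta)$ be a rotated double-line crease pattern of $V$ (as defined in the context). Then $DL(V,\theta)$ has a (nonconstant) rigid folding motion starting from the flat, unfolded state. Furthermore, $DL(V,\theta)$ has at least four distinct folding modes; namely, for each of the four sign sequences $$(-,+,+,-)\ (\text{mode a-I}),\quad (+,-,-,+)\ (\text{mode a-II}),\quad (+,+,-,-)\ (\text{mode b-I}),\quad (-,-,+,+)\ (\text{mode b-II}),$$ there is a nonconstant rigid folding motion of $DL(V,\theta)$ from the flat, unfolded state along which, for each $i=0,1,2,3$, the vertex $c_i$ folds in the $i$-th entry of the sign sequence.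
   Context: **Rigid folding.** A crease pattern $C$ is a straight-line planar graph drawn on a compact (disk-like) region $R$ of the plane. A rigid folded state is a piecewise isometric homeomorphism $\sigma:R\to\sigma(R)\subset\mathbb{R}^3$ that maps each face of $C$ to a congruent planar face. The fold angle of a crease is the signed angle between the normals of the images of its two incident faces (zero: unfolded; positive: valley; negative: mountain). A state is determined, up to rigid motion, by its fold angles. The configuration space is the set of vectors of fold angles coming from rigid folded states, and a rigid folding motion is a path in the configuration space. **Flat-foldable degree-4 vertex.** A vertex with four creases whose sector angles, in cyclic order, are such that opposite sector angles are supplementary. **The functions $p,q$.** For $x,y\in(0,\pi)$, $$p(x,y)=\frac{1-\tan\frac x2\tan\frac y2}{1+\tan\frac x2\tan\frac y2},\qquad q(x,y)=\frac{-\tan\frac x2+\tan\frac y2}{\tan\frac x2+\tan\frac y2}.$$ **Rotated double-line pattern $DL(V,\theta)$.** Let the creases of $V$ be rays from a point in unit directions $e_0,e_1,e_2,e_3$ in counterclockwise order, the counterclockwise angle from $e_i$ to $e_{i+1}$ being $\alpha_i$ (indices mod 4), with $(\alpha_0,\alpha_1,\alpha_2,\alpha_3)=(\pi-\alpha,\pi-\beta,\alpha,\beta)$. Let $P=c_0c_1c_2c_3$ be a convex quadrilateral with vertices in counterclockwise order such that the side $s_i=c_{i-1}c_i$, traversed from $c_{i-1}$ to $c_i$, has direction $e_i$ rotated counterclockwise by $\pi-\theta$ (so $\theta=\pi/2$ means that the side is perpendicular to $e_i$). $DL(V,\theta)$ consists of the four sides of $P$ together with, for each $i$, the two parallel rays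 in direction $e_i$ emanating from $c_{i-1}$ and from $c_i$ (the ''double line'' of $e_i$), restricted to a compact disk containing $P$ in its interior. At $c_i$ the four creases, in counterclockwise order, are: the side $s_i$, the ray of direction $e_i$, the ray of direction $e_{i+1}$, the side $s_{i+1}$; the sector angles between consecutive ones are $\theta,\ \alpha_i,\ \pi-\theta,\ \pi-\alpha_i$. So each $c_i$ is a flat-foldable degree-4 vertex. **Vertex modes.** Let the fold angles at $c_i$ of $s_i$, the ray of direction $e_i$, the ray of direction $e_{i+1}$, and $s_{i+1}$ be $\rho^0,\rho^1,\rho^2,\rho^3$. We say that $c_i$ folds in mode $+$ if $$\left(\tan\tfrac{\rho^0}{2},\tan\tfrac{\rho^1}{2},\tan\tfrac{\rho^2}{2},\tan\tfrac{\rho^3}{2}\right)=\bigl(1,\,-p(\theta,\alpha_i),\,1,\,p(\theta,\alpha_i)\bigr)\tau$$ for some $\tau$ depending on the state, and in mode $-$ if this vector equals $\bigl(-q(\theta,\alpha_i),\,1,\,q(\theta,\alpha_i),\,1\bigr)\tau$ for some $\tau$. Equivalently (when the quantities are defined and nonzero), the speed coefficient $p_i=\tan(\tfrac12\text{fold angle of }s_{i+1})/\tan(\tfrac12\text{fold angle of }s_i)$ is, in mode $-$ resp. mode $+$: $p_0=-p(\alpha,\theta)^{-1}$ resp. $-q(\alpha,\theta)$; $p_1=-p(\beta,\theta)^{-1}$ resp. $-q(\beta,\theta)$; $p_2=q(\alpha,\theta)^{-1}$ resp. $p(\alpha,\theta)$; $p_3=q(\beta,\theta)^{-1}$ resp.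 $p(\beta,\theta)$. A folding mode of $DL(V,\theta)$ is an assignment of $+$ or $-$ to $c_0,c_1,c_2,c_3$ realized by a nonconstant rigid folding motion from the flat state. *)

(* Defs.v *)
(* Points of the plane and of space are row vectors. *)
From HB Require Import structures.
From mathcomp Require Import all_boot all_order all_algebra.
From mathcomp Require Import all_classical all_reals all_analysis.

Set Implicit Arguments.
Unset Strict Implicit.
Unset Printing Implicit Defensive.

Import Order.TTheory GRing.Theory Num.Theory.
Import numFieldNormedType.Exports.

Local Open Scope classical_set_scope.
Local Open Scope ring_scope.

Section EuclideanGeometry.
Variable R : realType.
Implicit Types (n : nat) (t : R).

Definition vec2 (x y : R) : 'rV[R]_2 := \row_k nth 0 [:: x; y] k.

Definition dot n (u v : 'rV[R]_n) : R := \sum_k u 0 k * v 0 k.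

(* The library norm on ['rV_n] is the sup norm, hence this one. *)
Definition enorm n (u : 'rV[R]_n) : R := Num.sqrt (dot u u).

Definition cross2 (u v : 'rV[R]_2) : R := u 0 0 * v 0 1 - u 0 1 * v 0 0.

(* Indices in ['I_3] are added modulo 3. *)
Definition cross3 (u v : 'rV[R]_3) : 'rV[R]_3 :=
  \row_k (u 0 (k + 1) * v 0 (k + 2) - u 0 (k + 2) * v 0 (k + 1)).

(* Counterclockwise rotation by [t]. *)
Definition rotate t (v : 'rV[R]_2) : 'rV[R]_2 :=
  vec2 (cos t * v 0 0 - sin t * v 0 1) (sin t * v 0 0 + cos t * v 0 1).

Definition disk (o : 'rV[R]_2) (r : R) : set 'rV[R]_2 :=
  [set x | enorm (x - o) <= r].

Definition open_disk (o : 'rV[R]_2) (r : R) : set 'rV[R]_2 :=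
  [set x | enorm (x - o) < r].

Definition segment (a b : 'rV[R]_2) : set 'rV[R]_2 :=
  [set a + t *: (b - a) | t in `[0, 1]].

Definition open_segment (a b : 'rV[R]_2) : set 'rV[R]_2 :=
  [set a + t *: (b - a) | t in `]0, 1[].

Definition half_line (a d : 'rV[R]_2) : set 'rV[R]_2 :=
  [set a + t *: d | t in `[0, +oo[].

Definition homeomorphic_onto_image n m
    (A : set 'rV[R]_n) (f : 'rV[R]_n -> 'rV[R]_m) : Prop :=
  {within A, continuous f} /\
  exists g : 'rV[R]_m -> 'rV[R]_n,
    {within f @` A, continuous g} /\ {in A, cancel f g}.

Definition disk_like (A : set 'rV[R]_2) : Prop :=
  exists f : 'rV[R]_2 -> 'rV[R]_2,
    homeomorphic_onto_image (disk 0 1) f /\ f @` disk 0 1 = A.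

End EuclideanGeometry.

Section RigidFolding.
Variable R : realType.

(* A straight-line planar graph, given by its edges: the crease [k] is the
   segment from [crease_src k] to [crease_dst k]. The orientation of a crease
   is only a labelling: fold angles do not depend on it. *)
Record crease_pattern (K : finType) := CreasePattern {
  region : set 'rV[R]_2;
  crease_src : K -> 'rV[R]_2;
  crease_dst : K -> 'rV[R]_2;
  region_disk_like : disk_like region;
  crease_nondegenerate : forall k, crease_src k != crease_dst k;
  crease_in_region : forall k,
    segment (crease_src k) (crease_dst k) `<=` region;
  crease_planar : forall j k, j != k ->
    segment (crease_src j) (crease_dst j) `&`
      segment (crease_src k) (crease_dst k) `<=`
    [set crease_src j; crease_dst j] `&` [set crease_src k; crease_dst k]
}.

Variable K : finType.
Implicit Types (C : crease_pattern K) (F : set 'rV[R]_2) (k : K).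
Implicit Types (sigma : 'rV[R]_2 -> 'rV[R]_3).

Definition creases C : set 'rV[R]_2 :=
  \bigcup_k segment (crease_src C k) (crease_dst C k).

(* Faces are taken without their boundary. *)
Definition face C F : Prop :=
  exists2 x, (region C `\` creases C) x &
    F = connected_component (region C `\` creases C) x.

(* [sigma] coincides on [F] with [x |-> v + x *m B], where the rows of [B] are
   orthonormal, i.e. with an isometric embedding of the plane in space. *)
Definition congruent_on F sigma (v : 'rV[R]_3) (B : 'M[R]_(2, 3)) : Prop :=
  B *m B^T = 1%:M /\ forall x, F x -> sigma x = v + x *m B.

Definition rigid_folded_state C sigma : Prop :=
  homeomorphic_onto_image (region C) sigma /\
  forall F, face C F -> exists v B, congruent_on F sigma v B.

(* The image of the upward normal of the plane. *)
Definition normal (B : 'M[R]_(2, 3)) : 'rV[R]_3 := cross3 (row 0 B) (row 1 B).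

Definition crease_vec C k : 'rV[R]_2 := crease_dst C k - crease_src C k.

(* [F] borders the crease [k] on the side to which the vector [w] points. *)
Definition incident C k (w : 'rV[R]_2) F : Prop :=
  face C F /\
  forall x, open_segment (crease_src C k) (crease_dst C k) x ->
    \forall eps \near 0^'+, F (x + eps *: w).

(* [rho] is the angle from the normal on the left of the crease to the normal
   on its right, counted positively when the paper on both sides is bent towards
   the normals (valley). Reversing the crease exchanges left and right and
   changes the sign of the crease direction, so that [rho] is unchanged. *)
Definition is_fold_angle C sigma k (rho : R) : Prop :=
  - pi < rho <= pi /\
  exists FL vL BL FR vR BR,
    [/\ incident C k (rotate (pi / 2) (crease_vec C k)) FL
          /\ congruent_on FL sigma vL BL,
        incident C k (rotate (- (pi / 2)) (crease_vec C k)) FR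
          /\ congruent_on FR sigma vR BR,
        cos rho = dot (normal BL) (normal BR) &
        sin rho = dot ((enorm (crease_vec C k))^-1 *: (crease_vec C k *m BL))
                      (cross3 (normal BR) (normal BL))].

Definition configuration_space C : set (K -> R) :=
  [set rho | exists sigma, rigid_folded_state C sigma /\
                           forall k, is_fold_angle C sigma k (rho k)].

Definition rigid_folding_motion C (gamma : R -> K -> R) : Prop :=
  (forall t, t \in `[0, 1] -> configuration_space C (gamma t)) /\
  forall k, {within `[0, 1], continuous (fun t => gamma t k)}.

Definition from_flat (gamma : R -> K -> R) : Prop := forall k, gamma 0 k = 0.

Definition nonconstant (gamma : R -> K -> R) : Prop :=
  exists s t, [/\ s \in `[0, 1], t \in `[0, 1] & gamma s <> gamma t].

End RigidFolding.

Section DoubleLine.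
Variable R : realType.
Implicit Types (alpha beta theta : R) (a : 'I_4 -> R) (e c : 'I_4 -> 'rV[R]_2).

(* Indices in ['I_4] are added modulo 4. The creases of the vertex have unit
   directions [e i] and [a i] is the sector angle from [e i] to [e (i + 1)]. *)
Definition degree4_vertex a e : Prop :=
  [/\ forall i, 0 < a i,
      \sum_i a i = 2 * pi,
      forall i, enorm (e i) = 1 &
      forall i, e (i + 1) = rotate (a i) (e i)].

Definition flat_foldable_vertex a e : Prop :=
  degree4_vertex a e /\ forall i, a i + a (i + 2) = pi.

Definition sector_angles alpha beta : 'I_4 -> R :=
  fun i => nth 0 [:: pi - alpha; pi - beta; alpha; beta] i.

Definition convex_ccw_quadrilateral c : Prop :=
  forall i j, j != i - 1 -> j != i ->
    0 < cross2 (c i - c (i - 1)) (c j - c (i - 1)).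

Definition quadrilateral c : set 'rV[R]_2 :=
  [set x | exists w : 'I_4 -> R,
     [/\ forall i, 0 <= w i, \sum_i w i = 1 & x = \sum_i w i *: c i]].

(* [side i] joins [c (i - 1)] to [c i]; [ray i false] and [ray i true] have
   direction [e i] and emanate from [c (i - 1)] and from [c i]. *)
Definition dl_crease : finType := ('I_4 + 'I_4 * bool)%type.
Definition side (i : 'I_4) : dl_crease := inl i.
Definition ray (i : 'I_4) (b : bool) : dl_crease := inr (i, b).

Definition is_double_line e theta (C : crease_pattern R dl_crease) : Prop :=
  exists (c : 'I_4 -> 'rV[R]_2) (o : 'rV[R]_2) (r : R),
    [/\ convex_ccw_quadrilateral c /\
          forall i, exists2 l : R, 0 < l &
            c i - c (i - 1) = l *: rotate (pi - theta) (e i),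
        quadrilateral c `<=` open_disk o r,
        region C = disk o r,
        forall i, crease_src C (side i) = c (i - 1) /\
                  crease_dst C (side i) = c i &
        forall i b, let base := if b then c i else c (i - 1) in
          crease_src C (ray i b) = base /\
          segment (crease_src C (ray i b)) (crease_dst C (ray i b)) =
            half_line base (e i) `&` disk o r].

Definition pcoef (x y : R) : R :=
  (1 - tan (x / 2) * tan (y / 2)) / (1 + tan (x / 2) * tan (y / 2)).

Definition qcoef (x y : R) : R :=
  (- tan (x / 2) + tan (y / 2)) / (tan (x / 2) + tan (y / 2)).

(* Modes [+] and [-] are encoded by [true] and [false]. *)
Definition vertex_in_mode theta a (i : 'I_4) (s : bool)
    (rho : dl_crease -> R) : Prop :=
  exists tau : R,
    [seq tan (rho k / 2)
       | k <- [:: side i; ray i true; ray (i + 1) false; side (i + 1)]] =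
    [seq x * tau
       | x <- if s then [:: 1; - pcoef theta (a i); 1; pcoef theta (a i)]
              else [:: - qcoef theta (a i); 1; qcoef theta (a i); 1]].

Definition folding_mode theta a (C : crease_pattern R dl_crease)
    (m : 4.-tuple bool) : Prop :=
  exists gamma : R -> dl_crease -> R,
    [/\ rigid_folding_motion C gamma, from_flat gamma, nonconstant gamma &
        forall t, t \in `[0, 1] ->
          forall i, vertex_in_mode theta a i (tnth m i) (gamma t)].

End DoubleLine.

Definition mode_aI : 4.-tuple bool := [tuple false; true; true; false].
Definition mode_aII : 4.-tuple bool := [tuple true; false; false; true].
Definition mode_bI : 4.-tuple bool := [tuple true; true; false; false].
Definition mode_bII : 4.-tuple bool := [tuple false; false; true; true].

(* Main.v *)
(** A folded state is determined by the directions E_i of the images of the rays: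
    if P stays horizontal and E_i is e_i turned about the side s_i by its fold
    angle, the only constraint is that E_i and E_{i+1} make the angle alpha_i.
    In half-angle tangents this is a quadratic relation between consecutive
    sides, whose two linear factors are the two vertex modes. Since
    p(theta, pi - x) = q(theta, x), the four linear relations of each listed sign
    sequence have an explicit nonzero solution, which is then scaled by a small
    time parameter.

    To build the state, every point x of the plane is written y + w, where y in P
    is a skew projection of x and w lies in the cone spanned by the rays at y; the
    state maps x to y + (w folded as the single vertex V). The projection is
    characterised by a monotone variational inequality, hence is unique and
    Lipschitz; so for small fold angles the state is a Lipschitz-small
    perturbation of the inclusion of the plane, hence a homeomorphism onto its
    image. *)
Require Import Defs.
From HB Require Import structures.
From mathcomp Require Import all_boot all_order all_algebra.
From mathcomp Require Import all_classical all_reals all_analysis.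
From mathcomp Require Import ring lra.

Set Implicit Arguments.
Unset Strict Implicit.
Unset Printing Implicit Defensive.

Import Order.TTheory GRing.Theory Num.Theory.
Import numFieldNormedType.Exports.

Local Open Scope classical_set_scope.
Local Open Scope ring_scope.

(** The delicate point is global injectivity. There are nine faces (P, four strips, four sectors),
    and a comparison of every pair of folded faces would depend on the shape of P. A folded map that
    differs from the isometric inclusion by a map of Lipschitz constant at most 1/2 is injective
    with Lipschitz inverse at once, but this needs a single formula with a global Lipschitz bound
    rather than nine glued pieces. Euclidean nearest-point projection onto P provides one for
    [theta = pi / 2], where the rays are normal to the sides; for other angles the scalar product is
    replaced by a non-symmetric form that is still coercive, with constant [sin theta]. Uniqueness
    of the projection is used twice: it makes the formula agree on overlapping closed pieces, and it
    shows that no crease enters an open piece, so that the faces, defined as connected components,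
    can be identified. The mode relations are homogeneous in the half-angle tangents, so all
    tangents can be taken proportional to time. The Lipschitz estimate is uniform on the whole
    plane, so the admissible speed does not depend on the radius of the disk. *)

Lemma ord4_ind (P : 'I_4 -> Prop) : P 0 -> P 1 -> P 2 -> P 3 -> forall i, P i.
Proof.
move=> P0 P1 P2 P3 [[|[|[|[|//]]]] Hi].
- by rewrite (_ : Ordinal Hi = 0) //; apply: val_inj.
- by rewrite (_ : Ordinal Hi = 1) //; apply: val_inj.
- by rewrite (_ : Ordinal Hi = 2) //; apply: val_inj.
- by rewrite (_ : Ordinal Hi = 3) //; apply: val_inj.
Qed.

(** * Half-angle relations at a vertex *)

Section Coordinates.
Variable R : realType.
Implicit Types (u v w : 'rV[R]_2) (x y z : 'rV[R]_3) (a b c t T : R).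

Lemma vec2_0 a b : vec2 a b 0 0 = a. Proof. by rewrite mxE. Qed.
Lemma vec2_1 a b : vec2 a b 0 1 = b. Proof. by rewrite mxE. Qed.

Lemma row2P u v : u 0 0 = v 0 0 -> u 0 1 = v 0 1 -> u = v.
Proof.
move=> h0 h1; apply/rowP => -[[|[|//]] Hk].
- by rewrite (_ : Ordinal Hk = 0) //; apply: val_inj.
- by rewrite (_ : Ordinal Hk = 1) //; apply: val_inj.
Qed.

Lemma row3P x y : x 0 0 = y 0 0 -> x 0 1 = y 0 1 -> x 0 2 = y 0 2 -> x = y.
Proof.
move=> h0 h1 h2; apply/rowP => -[[|[|[|//]]] Hk].
- by rewrite (_ : Ordinal Hk = 0) //; apply: val_inj.
- by rewrite (_ : Ordinal Hk = 1) //; apply: val_inj.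
- by rewrite (_ : Ordinal Hk = 2) //; apply: val_inj.
Qed.

Lemma dot2E u v : dot u v = u 0 0 * v 0 0 + u 0 1 * v 0 1.
Proof.
rewrite /dot !big_ord_recl big_ord0 addr0.
by rewrite (_ : lift ord0 ord0 = 1) //; apply: val_inj.
Qed.

Lemma dot3E x y :
  dot x y = x 0 0 * y 0 0 + x 0 1 * y 0 1 + x 0 2 * y 0 2.
Proof.
rewrite /dot !big_ord_recl big_ord0 addr0 addrA.
rewrite (_ : lift ord0 (lift ord0 ord0) = 2); last exact: val_inj.
by rewrite (_ : lift ord0 ord0 = 1) //; apply: val_inj.
Qed.

Definition vec3 a b c : 'rV[R]_3 := \row_k nth 0 [:: a; b; c] k.

Lemma vec3_0 a b c : vec3 a b c 0 0 = a. Proof. by rewrite mxE. Qed.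
Lemma vec3_1 a b c : vec3 a b c 0 1 = b. Proof. by rewrite mxE. Qed.
Lemma vec3_2 a b c : vec3 a b c 0 2 = c. Proof. by rewrite mxE. Qed.

Lemma cross3_0 x y : cross3 x y 0 0 = x 0 1 * y 0 2 - x 0 2 * y 0 1.
Proof. by rewrite mxE !add0r. Qed.

Lemma cross3_1 x y : cross3 x y 0 1 = x 0 2 * y 0 0 - x 0 0 * y 0 2.
Proof.
rewrite mxE (_ : 1 + 1 = 2) //.
by rewrite (_ : 1 + 2 = 0) //; apply: val_inj.
Qed.

Lemma cross3_2 x y : cross3 x y 0 2 = x 0 0 * y 0 1 - x 0 1 * y 0 0.
Proof.
rewrite mxE (_ : 2 + 1 = 0); last exact: val_inj.
by rewrite (_ : 2 + 2 = 1) //; apply: val_inj.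
Qed.

Definition coord3E := (vec3_0, vec3_1, vec3_2, cross3_0, cross3_1, cross3_2).

Definition perp v : 'rV[R]_2 := vec2 (- v 0 1) (v 0 0).

Lemma rotate_0 t v : rotate t v 0 0 = cos t * v 0 0 - sin t * v 0 1.
Proof. by rewrite mxE. Qed.
Lemma rotate_1 t v : rotate t v 0 1 = sin t * v 0 0 + cos t * v 0 1.
Proof. by rewrite mxE. Qed.

Lemma perp_0 v : perp v 0 0 = - v 0 1. Proof. by rewrite mxE. Qed.
Lemma perp_1 v : perp v 0 1 = v 0 0. Proof. by rewrite mxE. Qed.

Definition coord2E := (vec2_0, vec2_1, rotate_0, rotate_1, perp_0, perp_1).

Lemma rotate_pihalf v : rotate (pi / 2) v = perp v.
Proof. by apply: row2P; rewrite !coord2E cos_pihalf sin_pihalf; ring. Qed.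

Lemma rotate_Npihalf v : rotate (- (pi / 2)) v = - perp v.
Proof.
by apply: row2P; rewrite !(coord2E, mxE) /= cosN sinN cos_pihalf sin_pihalf; ring.
Qed.

Lemma enorm_ge0 n (u : 'rV[R]_n) : 0 <= enorm u.
Proof. by rewrite /enorm sqrtr_ge0. Qed.

Lemma dot_ge0 n (u : 'rV[R]_n) : 0 <= dot u u.
Proof. by apply: sumr_ge0 => k _; rewrite -expr2 sqr_ge0. Qed.

Lemma enorm_sqr n (u : 'rV[R]_n) : enorm u ^+ 2 = dot u u.
Proof. by rewrite /enorm sqr_sqrtr ?dot_ge0. Qed.

Lemma enorm_le n (u : 'rV[R]_n) t : 0 <= t -> (enorm u <= t) = (dot u u <= t ^+ 2).
Proof. by move=> t0; rewrite -enorm_sqr ler_sqr ?nnegrE ?enorm_ge0. Qed.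

Lemma enorm_lt n (u : 'rV[R]_n) t : 0 <= t -> (enorm u < t) = (dot u u < t ^+ 2).
Proof. by move=> t0; rewrite -enorm_sqr ltr_sqr ?nnegrE ?enorm_ge0. Qed.

(* [T] and [T'] are the half-angle tangents of the sides [s_i] and [s_{i+1}].
   Not dividing by [p] or [q] covers the cases where they vanish. *)
Definition mode_rel (s : bool) t a T (T' : R) : Prop :=
  if s then T' = pcoef t a * T else T = - qcoef t a * T'.

(** Cosine and sine of the angle [2 * atan T] as rational functions of [T]: trigonometric identities
    then become rational ones, within reach of [field]. *)
Definition cosw T : R := (1 - T ^+ 2) / (1 + T ^+ 2).
Definition sinw T : R := 2 * T / (1 + T ^+ 2).

Lemma den_gt0 T : 0 < 1 + T ^+ 2.
Proof. by rewrite ltr_pwDl // sqr_ge0. Qed.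

Lemma den_neq0 T : 1 + T ^+ 2 != 0.
Proof. by rewrite gt_eqF ?den_gt0. Qed.

Lemma cosw_sinw T : cosw T ^+ 2 + sinw T ^+ 2 = 1.
Proof. by rewrite /cosw /sinw; field; exact: den_neq0. Qed.

Lemma coswN T : cosw (- T) = cosw T.
Proof. by rewrite /cosw sqrrN. Qed.
Lemma sinwN T : sinw (- T) = - sinw T.
Proof. by rewrite /sinw sqrrN mulrN mulNr. Qed.

Lemma half_in_range a : 0 < a < pi -> 0 < a / 2 < pi / 2.
Proof. by move=> /andP[a0 ap]; apply/andP; split; lra. Qed.

Lemma tan_half_gt0 a : 0 < a < pi -> 0 < tan (a / 2).
Proof.
move=> /half_in_range /andP[h0 h1]; rewrite /tan divr_gt0 //.
  by rewrite sin_gt0_pi // h0 /=; have := @pi_gt0 R; lra.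
by rewrite cos_gt0_pihalf // h1 andbT; have := @pi_gt0 R; lra.
Qed.

Lemma cosw_tan a : cos a != 0 -> cosw (tan a) = cos (a + a).
Proof.
move=> c0; have cs := cos2Dsin2 a; rewrite cosD /cosw /tan.
have -> : 1 + (sin a / cos a) ^+ 2 = (cos a ^+ 2)^-1.
  by rewrite -[RHS]mul1r -[X in X / _]cs; field.
by field.
Qed.

Lemma sinw_tan a : cos a != 0 -> sinw (tan a) = sin (a + a).
Proof.
move=> c0; have cs := cos2Dsin2 a; rewrite sinD /sinw /tan.
have -> : 1 + (sin a / cos a) ^+ 2 = (cos a ^+ 2)^-1.
  by rewrite -[RHS]mul1r -[X in X / _]cs; field.
by field.
Qed.

Lemma cos_half_neq0 a : 0 < a < pi -> cos (a / 2) != 0.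
Proof.
move=> /half_in_range /andP[h0 h1]; apply/lt0r_neq0.
by rewrite cos_gt0_pihalf // h1 andbT; have := @pi_gt0 R; lra.
Qed.

Lemma cos_half a : 0 < a < pi -> cos a = cosw (tan (a / 2)).
Proof. by move=> /cos_half_neq0 c0; rewrite cosw_tan // -splitr. Qed.

Lemma sin_half a : 0 < a < pi -> sin a = sinw (tan (a / 2)).
Proof. by move=> /cos_half_neq0 c0; rewrite sinw_tan // -splitr. Qed.

Lemma cos_atan_neq0 T : cos (atan T) != 0.
Proof.
by apply/lt0r_neq0; rewrite cos_gt0_pihalf // atan_gtNpi2 atan_ltpi2.
Qed.

Lemma cos_2atan T : cos (2 * atan T) = cosw T.
Proof.
by rewrite mulr_natl mulr2n -cosw_tan ?atanK // cos_atan_neq0.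
Qed.

Lemma sin_2atan T : sin (2 * atan T) = sinw T.
Proof.
by rewrite mulr_natl mulr2n -sinw_tan ?atanK // cos_atan_neq0.
Qed.

Section HalfAngle.
Variables u v T T' : R.

(* [modep] and [modem] vanish in mode [+] and in mode [-] respectively. *)
Let modep := (1 + u * v) * T' - (1 - u * v) * T.
Let modem := (u - v) * T' - (u + v) * T.
Let D := (1 + T ^+ 2) * (1 + T' ^+ 2) * (1 + u ^+ 2) * (1 + v ^+ 2).

(** With [u] and [v] the half-angle tangents of [theta] and of the sector angle, the left-hand side
    is the scalar product of the two folded ray directions minus the cosine of the sector angle,
    divided by [sin theta]. Its numerator splits into the two modes. *)
Lemma closure_factor :
  - cosw u * sinw v * (cosw T' - cosw T)
  + sinw u * (cosw T * cosw T' * cosw v + sinw T * sinw T' - cosw v)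
  = - 4 * modep * modem / D.
Proof.
by rewrite /D /cosw /sinw /modep /modem; field; rewrite !den_neq0.
Qed.

(** The first two terms are the sine of the fold angle of [ray i true], times the sine of the sector
    angle. The closing condition fixes the ray angles only up to sign; each mode selects one sign,
    hence one factorisation per mode. *)
Lemma left_ray_factor_p :
  cosw T * sinw T' * sinw u
  - sinw T * (cosw u * sinw v + sinw u * cosw T' * cosw v) + sinw v * sinw T'
  = 4 * modep * ((u + v) + (u - v) * (T * T')) / D.
Proof.
by rewrite /D /cosw /sinw /modep; field; rewrite !den_neq0.
Qed.

Lemma left_ray_factor_m :
  cosw T * sinw T' * sinw u
  - sinw T * (cosw u * sinw v + sinw u * cosw T' * cosw v) - sinw v * sinw T'
  = 4 * modem * ((1 - u * v) + (1 + u * v) * (T * T')) / D.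
Proof.
by rewrite /D /cosw /sinw /modem; field; rewrite !den_neq0.
Qed.

Lemma right_ray_factor_p :
  cosw T' * sinw T * sinw u
  + sinw T' * (cosw u * sinw v - sinw u * cosw T * cosw v) - sinw v * sinw T
  = - 4 * modep * ((u - v) + (u + v) * (T * T')) / D.
Proof.
by rewrite /D /cosw /sinw /modep; field; rewrite !den_neq0.
Qed.

Lemma right_ray_factor_m :
  cosw T' * sinw T * sinw u
  + sinw T' * (cosw u * sinw v - sinw u * cosw T * cosw v) + sinw v * sinw T
  = - 4 * modem * ((1 + u * v) + (1 - u * v) * (T * T')) / D.
Proof.
by rewrite /D /cosw /sinw /modem; field; rewrite !den_neq0.
Qed.

End HalfAngle.

Section Vertex.
Variables (s : bool) (t a T T' : R).
Hypotheses (ht : 0 < t < pi) (ha : 0 < a < pi) (hm : mode_rel s t a T T').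

Lemma mode_relE : let u := tan (t / 2) in let v := tan (a / 2) in
  if s then (1 + u * v) * T' - (1 - u * v) * T = 0
  else (u - v) * T' - (u + v) * T = 0.
Proof.
have u0 := tan_half_gt0 ht; have v0 := tan_half_gt0 ha.
move: hm; rewrite /mode_rel /pcoef /qcoef.
move: u0 v0; set u := tan (t / 2); set v := tan (a / 2) => u0 v0 /=.
have uv : 1 + u * v != 0 by rewrite gt_eqF // addr_gt0 // mulr_gt0.
have uv' : u + v != 0 by rewrite gt_eqF // addr_gt0.
by case: (s) => ->; field.
Qed.

Lemma vertex_closed :
  - cos t * sin a * (cosw T' - cosw T)
  + sin t * (cosw T * cosw T' * cos a + sinw T * sinw T' - cos a) = 0.
Proof.
rewrite !(cos_half ht, cos_half ha, sin_half ht, sin_half ha) closure_factor.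
by have := mode_relE; case: (s) => /= ->; rewrite ?mulr0 !mul0r.
Qed.

Lemma left_ray_sin :
  cosw T * sinw T' * sin t
  - sinw T * (cos t * sin a + sin t * cosw T' * cos a)
  = sin a * sinw (if s then - T' else T').
Proof.
rewrite !(cos_half ht, cos_half ha, sin_half ht, sin_half ha).
have := mode_relE; case: (s) => /= E; apply: subr0_eq.
  by rewrite sinwN mulrN opprK left_ray_factor_p E mulr0 !mul0r.
by rewrite left_ray_factor_m E mulr0 !mul0r.
Qed.

Lemma right_ray_sin :
  cosw T' * sinw T * sin t
  + sinw T' * (cos t * sin a - sin t * cosw T * cos a)
  = sin a * sinw (if s then T else - T).
Proof.
rewrite !(cos_half ht, cos_half ha, sin_half ht, sin_half ha).
have := mode_relE; case: (s) => /= E; apply: subr0_eq.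
  by rewrite right_ray_factor_p E mulr0 !mul0r.
by rewrite sinwN mulrN opprK right_ray_factor_m E mulr0 !mul0r.
Qed.

End Vertex.
End Coordinates.

Section DotProduct.
Variables (R : realType) (n : nat).
Implicit Types (u v w : 'rV[R]_n) (t : R).

Lemma dotC u v : dot u v = dot v u.
Proof. by apply: eq_bigr => k _; rewrite mulrC. Qed.

Lemma dotDr u v w : dot u (v + w) = dot u v + dot u w.
Proof. by rewrite /dot -big_split; apply: eq_bigr => k _; rewrite mxE mulrDr. Qed.

Lemma dotZr t u v : dot u (t *: v) = t * dot u v.
Proof. by rewrite /dot mulr_sumr; apply: eq_bigr => k _; rewrite mxE mulrCA. Qed.

Lemma dotNr u v : dot u (- v) = - dot u v.
Proof. by rewrite -scaleN1r dotZr mulN1r. Qed.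

Lemma dotBr u v w : dot u (v - w) = dot u v - dot u w.
Proof. by rewrite dotDr dotNr. Qed.

Lemma dotDl u v w : dot (u + v) w = dot u w + dot v w.
Proof. by rewrite dotC dotDr !(dotC w). Qed.

Lemma dotZl t u v : dot (t *: u) v = t * dot u v.
Proof. by rewrite dotC dotZr dotC. Qed.

End DotProduct.

Section Plane.
Variable R : realType.
Implicit Types (u v w x : 'rV[R]_2) (t : R).

Lemma crossC u v : cross2 u v = - cross2 v u.
Proof. by rewrite /cross2; ring. Qed.

Lemma crossxx u : cross2 u u = 0.
Proof. by rewrite /cross2; ring. Qed.

Lemma crossDr u v w : cross2 u (v + w) = cross2 u v + cross2 u w.
Proof. by rewrite /cross2 !mxE; ring. Qed.

Lemma crossZr t u v : cross2 u (t *: v) = t * cross2 u v.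
Proof. by rewrite /cross2 !mxE; ring. Qed.

Lemma crossNr u v : cross2 u (- v) = - cross2 u v.
Proof. by rewrite /cross2 !mxE; ring. Qed.

Lemma crossDl u v w : cross2 (u + v) w = cross2 u w + cross2 v w.
Proof. by rewrite /cross2 !mxE; ring. Qed.

Lemma crossZl t u v : cross2 (t *: u) v = t * cross2 u v.
Proof. by rewrite /cross2 !mxE; ring. Qed.

Lemma cramer u v x : cross2 u v != 0 ->
  x = (cross2 x v / cross2 u v) *: u + (cross2 u x / cross2 u v) *: v.
Proof. by move=> uv; apply: row2P; rewrite !mxE /cross2; field. Qed.

End Plane.

Lemma ord4_sum (V : nmodType) (G : 'I_4 -> V) (i : 'I_4) :
  \sum_j G j = G i + G (i + 1) + G (i + 1 + 1) + G (i + 1 + 1 + 1).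
Proof.
have E (a b : 'I_4) : val a = val b -> G a = G b by move=> /val_inj ->.
rewrite !big_ord_recl big_ord0 addr0.
elim/ord4_ind: i; rewrite (E (lift ord0 ord0) 1) // (E (lift ord0 (lift _ _)) 2) //
  (E (lift ord0 (lift ord0 _)) 3) // (E ord0 0) //.
- by rewrite (E (0 + 1) 1) // (E (0 + 1 + 1) 2) // (E (0+1+1+1) 3) // !addrA.
- rewrite (E (1 + 1) 2) // (E (1 + 1 + 1) 3) // (E (1+1+1+1) 0) //.
  by rewrite addrC !addrA.
- rewrite (E (2 + 1) 3) // (E (2 + 1 + 1) 0) // (E (2+1+1+1) 1) //.
  by rewrite addrA addrC !addrA.
- rewrite (E (3 + 1) 0) // (E (3 + 1 + 1) 1) // (E (3+1+1+1) 2) //.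
  by rewrite !addrA addrC !addrA.
Qed.

Lemma ord4_add4 (i : 'I_4) : i + 1 + 1 + 1 + 1 = i.
Proof. by elim/ord4_ind: i; apply: val_inj. Qed.

(** * Decomposition of the plane and skew projection *)

(* [nrm i] is the outward unit normal of the side from [vtx (i - 1)] to
   [vtx i]. *)
Record double_line (R : realType) := DoubleLine {
  theta : R;
  angle : 'I_4 -> R;
  nrm : 'I_4 -> 'rV[R]_2;
  vtx : 'I_4 -> 'rV[R]_2;
  len : 'I_4 -> R;
  theta_range : 0 < theta < pi;
  angle_range : forall i, 0 < angle i < pi;
  nrm_unit : forall i, dot (nrm i) (nrm i) = 1;
  nrm_next : forall i, nrm (i + 1) = rotate (angle i) (nrm i);
  len_gt0 : forall i, 0 < len i;
  side_eq : forall i, vtx i - vtx (i - 1) = len i *: perp (nrm i);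
  vtx_convex : forall i j, j != i - 1 -> j != i -> dot (nrm i) (vtx j - vtx i) < 0
}.

Section DoubleLineGeometry.
Variables (R : realType) (D : double_line R).
Implicit Types (i j : 'I_4) (u v w x y z : 'rV[R]_2).
Local Notation st := (sin (theta D)).
Local Notation ct := (cos (theta D)).
Local Notation sa i := (sin (angle D i)).
Local Notation ca i := (cos (angle D i)).
Local Notation n := (nrm D).
Local Notation c := (vtx D).
Local Notation l := (len D).

Definition dir i := st *: n i - ct *: perp (n i).
Local Notation e := dir.

Lemma st_gt0 : 0 < st. Proof. exact: sin_gt0_pi (theta_range D). Qed.
Lemma sa_gt0 i : 0 < sa i. Proof. exact: sin_gt0_pi (angle_range D i). Qed.
Lemma st_neq0 : st != 0. Proof. exact/lt0r_neq0/st_gt0. Qed.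
Lemma sa_neq0 i : sa i != 0. Proof. exact/lt0r_neq0/sa_gt0. Qed.
Lemma len_neq0 i : l i != 0. Proof. exact/lt0r_neq0/len_gt0. Qed.

Lemma dot_next i v :
  dot (n (i + 1)) v = ca i * dot (n i) v + sa i * dot (perp (n i)) v.
Proof. by rewrite nrm_next !dot2E !coord2E; ring. Qed.

Lemma dot_perp_next i v :
  dot (perp (n (i + 1))) v = ca i * dot (perp (n i)) v - sa i * dot (n i) v.
Proof. by rewrite nrm_next !dot2E !coord2E; ring. Qed.

Lemma dot_perp u : dot u (perp u) = 0.
Proof. by rewrite dot2E !coord2E; ring. Qed.

Lemma dot_perp_perp u v : dot (perp u) (perp v) = dot u v.
Proof. by rewrite !dot2E !coord2E; ring. Qed.

Lemma cross_dir i v : cross2 (e i) v = st * dot (perp (n i)) v + ct * dot (n i) v.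
Proof. by rewrite /dir /cross2 !dot2E !(coord2E, mxE) /=; ring. Qed.

Lemma dot_dir i : dot (e i) (e i) = 1.
Proof.
rewrite -[RHS]mulr1 -[X in X * _](nrm_unit D i) -(cos2Dsin2 (theta D)).
by rewrite /dir !dot2E !(coord2E, mxE) /=; ring.
Qed.

Lemma dot_nrm_dir i : dot (n i) (e i) = st.
Proof. by rewrite /dir dotBr !dotZr dot_perp nrm_unit; ring. Qed.

Lemma dot_perp_dir i : dot (perp (n i)) (e i) = - ct.
Proof.
by rewrite /dir dotBr !dotZr dotC dot_perp dot_perp_perp nrm_unit; ring.
Qed.

Lemma cross_dir_next i : cross2 (e i) (e (i + 1)) = sa i.
Proof.
have h := dot_next i (e (i + 1)); have h' := dot_perp_next i (e (i + 1)).
have cs := cos2Dsin2 (theta D); have cs' := cos2Dsin2 (angle D i).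
rewrite cross_dir; move: h h'; rewrite dot_nrm_dir dot_perp_dir.
set A := dot (n i) _; set B := dot (perp (n i)) _ => h h'.
(* [A] and [B] are the coordinates of [e (i + 1)] in the frame [n i], [perp (n i)]; [h] and [h']
   give them after a rotation by [angle D i], which is inverted here. *)
have -> : B = sa i * st - ca i * ct.
  by rewrite h -[ct]opprK h' -[B]mul1r -[in LHS]cs'; ring.
have -> : A = ca i * st + sa i * ct.
  by rewrite h -[ct]opprK h' -[A]mul1r -[in LHS]cs'; ring.
by rewrite -[RHS]mul1r -cs; ring.
Qed.

Lemma dir_next i : e (i + 1) = rotate (angle D i) (e i).
Proof. by rewrite /dir nrm_next; apply: row2P; rewrite !(coord2E, mxE) /=; ring. Qed.

(** Signed distances to the line of a side and to the lines of its two rays: [side_fun] is positive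
    outside P, and the ray functions are positive to the left of the ray. They differ by the width
    [l i * st] of the strip. *)
Definition side_fun i x := dot (n i) (x - c i).
Definition ray_fun0 i x := cross2 (e i) (x - c (i - 1)).
Definition ray_fun1 i x := cross2 (e i) (x - c i).
Local Notation N := side_fun.
Local Notation f := ray_fun0.
Local Notation g := ray_fun1.

Lemma vtx_prev i : c (i - 1) = c i - l i *: perp (n i).
Proof. by rewrite -side_eq subKr. Qed.

Lemma N_prev i x : N i x = dot (n i) (x - c (i - 1)).
Proof. by rewrite /side_fun vtx_prev !dotBr dotZr dot_perp; ring. Qed.

Lemma fE i x : f i x = g i x + l i * st.
Proof.
rewrite /ray_fun0 /ray_fun1 vtx_prev !cross_dir !dotBr !dotZr dot_perp dot_perp_perp nrm_unit.
by ring.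
Qed.

End DoubleLineGeometry.

Section Pieces.
Variables (R : realType) (D : double_line R).
Implicit Types (i j : 'I_4) (u v w x y z : 'rV[R]_2) (s a b t : R).
Local Notation st := (sin (theta D)).
Local Notation ct := (cos (theta D)).
Local Notation sa i := (sin (angle D i)).
Local Notation ca i := (cos (angle D i)).
Local Notation n := (nrm D).
Local Notation c := (vtx D).
Local Notation l := (len D).
Local Notation e := (dir D).
Local Notation N := (side_fun D).
Local Notation f := (ray_fun0 D).
Local Notation g := (ray_fun1 D).

(* The closed faces: P, the strip between the two rays of direction [e i], and the
   sector at [c i]. *)
Definition inP x := forall j, N j x <= 0.
Definition inS i x := [/\ 0 <= N i x, 0 <= f i x & g i x <= 0].
Definition inC i x := 0 <= g i x /\ f (i + 1) x <= 0.

Lemma N_next i x :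
  N (i + 1) x = ca i * N i x + sa i * dot (perp (n i)) (x - c i).
Proof. by rewrite N_prev addrK dot_next. Qed.

Lemma f_next i x : f (i + 1) x =
  st * (ca i * dot (perp (n i)) (x - c i) - sa i * N i x) + ct * N (i + 1) x.
Proof.
by rewrite /ray_fun0 addrK cross_dir dot_perp_next (N_prev D (i + 1)) addrK.
Qed.

Lemma gE i x : g i x = st * dot (perp (n i)) (x - c i) + ct * N i x.
Proof. by rewrite /ray_fun1 cross_dir. Qed.

(* If [phi] is the angle from the side [i] to [x - c i] at [c i], then [N i x],
   [g i x], [f (i + 1) x], [N (i + 1) x] are proportional to the sines of [phi],
   [phi - theta], [phi - theta - angle i], [phi - angle i], and [E1] and [E2] are
   the three-term sine identities. *)
Lemma N_forward i x : 0 < N i x -> 0 < g i x -> 0 < f (i + 1) x ->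
  0 < N (i + 1) x.
Proof.
rewrite f_next N_next gE; set A := N i x; set B := dot _ _ => A0 g0 f0.
have := st_gt0 D; have := sa_gt0 D i.
have := cos2Dsin2 (theta D); have := cos2Dsin2 (angle D i).
move: g0 f0; set s1 := st; set c1 := ct; set s2 := sa i; set c2 := ca i.
move=> g0 f0 cs2 cs1 s20 s10.
set F := (s1 * _ + _) in f0; set G := (s1 * _ + _) in g0.
have E1 : G * (s1 * c2 + c1 * s2) = A * s2 + F * s1.
  apply/eqP; rewrite -subr_eq0; apply/eqP.
  transitivity (A * s2 * (c1 ^+ 2 + s1 ^+ 2 - 1)); last by rewrite cs1; ring.
  by rewrite /G /F; ring.
have p0 : 0 < s1 * c2 + c1 * s2.
  by rewrite -(pmulr_rgt0 _ g0) E1 addr_gt0 // mulr_gt0.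
have E2 : (s1 * c2 + c1 * s2) * (c2 * A + s2 * B) = A * s1 + F * s2.
  apply/eqP; rewrite -subr_eq0; apply/eqP.
  transitivity (A * s1 * (c2 ^+ 2 + s2 ^+ 2 - 1)); last by rewrite cs2; ring.
  by rewrite /F; ring.
by rewrite -(pmulr_rgt0 _ p0) E2 addr_gt0 // mulr_gt0.
Qed.

(** The mirror case of [N_forward]: the sine of [theta - angle i] takes the place of the sine of
    [theta + angle i], and its positivity again follows from the sign assumptions. *)
Lemma N_backward i x : 0 < N (i + 1) x -> f (i + 1) x < 0 -> g i x < 0 ->
  0 < N i x.
Proof.
rewrite f_next N_next gE; set A := N i x; set B := dot _ _ => A0 f0 g0.
have := st_gt0 D; have := sa_gt0 D i.
have := cos2Dsin2 (theta D); have := cos2Dsin2 (angle D i).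
move: A0 f0 g0; set s1 := st; set c1 := ct; set s2 := sa i; set c2 := ca i.
move=> A0 f0 g0 cs2 cs1 s20 s10.
set A' := c2 * A + s2 * B in A0 f0 *.
set F := (s1 * _ + _) in f0; set G := (s1 * _ + _) in g0.
have E1 : - F * (s1 * c2 - c1 * s2) = - G * s1 + A' * s2.
  apply/eqP; rewrite -subr_eq0; apply/eqP.
  transitivity (s2 * A' * (c1 ^+ 2 + s1 ^+ 2 - 1)
     + G * s1 * (1 - (c2 ^+ 2 + s2 ^+ 2))); last by rewrite cs1 cs2; ring.
  by rewrite /G /F /A'; ring.
have p0 : 0 < s1 * c2 - c1 * s2.
  by rewrite -(@pmulr_rgt0 _ (- F)) ?oppr_gt0 // E1 addr_gt0 // mulr_gt0 // oppr_gt0.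
have E2 : (s1 * c2 - c1 * s2) * A = A' * s1 - G * s2.
  apply/eqP; rewrite -subr_eq0; apply/eqP.
  by rewrite /G /A'; ring.
by rewrite -(pmulr_rgt0 _ p0) E2 -mulNr addr_gt0 // mulr_gt0 // oppr_gt0.
Qed.

Lemma len_N i x : l i * N i x = cross2 (x - c i) (c i - c (i - 1)).
Proof. by rewrite side_eq /side_fun dot2E /cross2 !(coord2E, mxE) /=; ring. Qed.

(* The sum of the [l i * N i x] is minus twice the area of P. *)
Lemma ex_N_le0 x : exists i, N i x <= 0.
Proof.
apply: contrapT => nh.
have p i : 0 < cross2 (x - c i) (c i - c (i - 1)).
  rewrite -len_N mulr_gt0 ?len_gt0 // ltNge; apply/negP => q.
  by apply: nh; exists i.
have q i j : j != i - 1 -> j != i -> cross2 (c j - c i) (c i - c (i - 1)) < 0.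
  by move=> h1 h2; rewrite -len_N pmulr_rlt0 ?len_gt0 // /side_fun vtx_convex.
have := p 0; have := p 1; have := p 2; have := p 3.
have := @q 1 2 isT isT; have := @q 3 0 isT isT.
have E (a b : 'I_4) : val a = val b -> c a = c b by move=> /val_inj ->.
rewrite (E (0 - 1) 3) // (E (1 - 1) 0) // (E (2 - 1) 1) // (E (3 - 1) 2) //.
by rewrite /cross2 !mxE; lra.
Qed.

Lemma ord4_cycle (Q : 'I_4 -> Prop) i :
  (forall j, Q j -> Q (j + 1)) -> Q i -> forall j, Q j.
Proof.
move=> h Qi j; have -> : j = i + (j - i) by rewrite addrC subrK.
elim/ord4_ind: (j - i).
- by rewrite addr0.
- exact: h.
- by rewrite (_ : 2 = 1 + 1) // addrA; exact: h (h _ Qi).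
- have -> : i + 3 = i + 1 + 1 + 1 by rewrite -!addrA; congr (_ + _); apply: val_inj.
  exact: h (h _ (h _ Qi)).
Qed.

(* A point outside all the pieces would lie outside every side of P, by going
   around P either forward or backward. *)
Lemma cover x : [\/ inP x, exists i, inS i x | exists i, inC i x].
Proof.
apply: contrapT => nh.
have nS i : 0 < N i x -> 0 <= f i x -> 0 < g i x.
  move=> Ni fi; rewrite ltNge; apply/negP => gi.
  by apply: nh; apply: Or32; exists i; split => //; apply: ltW.
have nC i : 0 <= g i x -> 0 < f (i + 1) x.
  move=> gi; rewrite ltNge; apply/negP => fi.
  by apply: nh; apply: Or33; exists i.
have [i Ni] : exists i, 0 < N i x.
  apply: contrapT => h'; apply: nh; apply: Or31 => i.
  by rewrite leNgt; apply/negP => p; apply: h'; exists i.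
have [j] := ex_N_le0 x; apply/negP; rewrite -ltNge.
have [fi|fi] := leP 0 (f i x).
  have H k : 0 < N k x /\ 0 < g k x -> 0 < N (k + 1) x /\ 0 < g (k + 1) x.
    move=> [Nk gk]; have fk := nC k (ltW gk).
    have Nk' := N_forward Nk gk fk; split => //.
    by apply: nS => //; apply: ltW.
  by have [] := ord4_cycle H (conj Ni (nS i Ni fi)) j.
have H k : 0 < N (k + 1) x /\ f (k + 1) x < 0 -> 0 < N k x /\ f k x < 0.
  move=> [Nk fk].
  have gk : g k x < 0.
    by rewrite ltNge; apply/negP => /nC; rewrite ltNge (ltW fk).
  have Nk' := N_backward Nk fk gk; split => //.
  by rewrite ltNge; apply/negP => /(nS _ Nk'); rewrite ltNge (ltW gk).
have H' k : 0 < N (- k) x /\ f (- k) x < 0 ->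
    0 < N (- (k + 1)) x /\ f (- (k + 1)) x < 0.
  move=> h1; apply: H.
  by rewrite opprD addrNK.
rewrite -[j]opprK.
by have [] := @ord4_cycle (fun k => 0 < N (- k) x /\ f (- k) x < 0) (- i) H' _ (- j);
  rewrite ?opprK.
Qed.

Definition skew u v := st * dot u v + ct * cross2 u v.

Lemma skewDl u v w : skew (u + v) w = skew u w + skew v w.
Proof. by rewrite /skew dotDl crossDl; ring. Qed.

Lemma skewZl t u v : skew (t *: u) v = t * skew u v.
Proof. by rewrite /skew dotZl crossZl; ring. Qed.

Lemma skew_dir i v : skew (e i) v = dot (n i) v.
Proof.
rewrite /skew -[RHS]mul1r -(cos2Dsin2 (theta D)) /dir /cross2 !dot2E.
by rewrite !(coord2E, mxE) /=; ring.
Qed.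

(* The bilinear form turns [e_i] into the outward normal of the side [i], so
   that the inequality says that [x - y] lies in the cone of the rays at [y].
   It is monotone because [skew u u = sin theta * dot u u]. *)
Definition isproj x y := inP y /\ forall z, inP z -> skew (x - y) (z - y) <= 0.

(** Put [w = y - y'] and [d = x - x']. Testing each inequality at the other projection and adding
    gives [sin theta * |w|^2 <= w . M d], where [M] is a rotation by [pi / 2 - theta]. Expanding
    [|M d - sin theta * w|^2 >= 0] then plays the part of the Cauchy-Schwarz inequality. *)
Lemma isproj_lip x y x' y' : isproj x y -> isproj x' y' ->
  st ^+ 2 * dot (y - y') (y - y') <= dot (x - x') (x - x').
Proof.
move=> [Py h] [Py' h']; have := h _ Py'; have := h' _ Py => {h h'}.
have := st_gt0 D; have := cos2Dsin2 (theta D).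
rewrite /skew /cross2 !dot2E !mxE.
move: (x 0 0) (x 0 1) (y 0 0) (y 0 1) (x' 0 0) (x' 0 1) (y' 0 0) (y' 0 1).
move=> x0 x1 y0 y1 x0' x1' y0' y1'; set s := st; set k := ct => cs s0 h1 h2.
set w0 := y0 - y0'; set w1 := y1 - y1'; set d0 := x0 - x0'; set d1 := x1 - x1'.
have h3 : s * (w0 * w0 + w1 * w1) <= w0 * (s * d0 - k * d1) + w1 * (s * d1 + k * d0).
  by move: h1 h2; rewrite /w0 /w1 /d0 /d1; lra.
have q : 0 <= (s * d0 - k * d1 - s * w0) ^+ 2 + (s * d1 + k * d0 - s * w1) ^+ 2.
  by rewrite addr_ge0 ?sqr_ge0.
have E : (s * d0 - k * d1 - s * w0) ^+ 2 + (s * d1 + k * d0 - s * w1) ^+ 2 =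
  (k ^+ 2 + s ^+ 2) * (d0 * d0 + d1 * d1) + s ^+ 2 * (w0 * w0 + w1 * w1)
  - 2 * s * (w0 * (s * d0 - k * d1) + w1 * (s * d1 + k * d0)) by ring.
rewrite E cs mul1r in q.
have h4 := ler_wpM2l (ltW s0) h3.
have -> : s ^+ 2 * (w0 * w0 + w1 * w1) = s * (s * (w0 * w0 + w1 * w1)) by ring.
by move: q; rewrite expr2 -!mulrA; lra.
Qed.

Lemma dot_eq0 u : dot u u <= 0 -> u = 0.
Proof.
rewrite dot2E -!expr2 => h.
have h0 := sqr_ge0 (u 0 0); have h1 := sqr_ge0 (u 0 1).
apply: row2P; rewrite mxE; apply/eqP; rewrite -sqrf_eq0 eq_le sqr_ge0 andbT; lra.
Qed.

Lemma isproj_uniq x y y' : isproj x y -> isproj x y' -> y = y'.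
Proof.
move=> h h'; have := isproj_lip h h'; rewrite subrr.
rewrite [leRHS]dot2E !mxE !mulr0 addr0 pmulr_rle0 ?exprn_gt0 ?st_gt0 //.
by move=> /dot_eq0 /subr0_eq.
Qed.

Lemma N_vtx i : N i (c i) = 0.
Proof. by rewrite /side_fun subrr dot2E !mxE !mulr0 addr0. Qed.

Lemma N_vtx_prev i : N i (c (i - 1)) = 0.
Proof. by rewrite N_prev subrr dot2E !mxE !mulr0 addr0. Qed.

Lemma inP_vtx i : inP (c i).
Proof.
move=> j; have [->|h] := eqVneq i (j - 1); first by rewrite N_vtx_prev.
have [->|h'] := eqVneq i j; first by rewrite N_vtx.
by apply: ltW; apply: vtx_convex.
Qed.

Definition sidept i s := c (i - 1) + s *: (c i - c (i - 1)).

Lemma N_sidept j i s : N j (sidept i s) = (1 - s) * N j (c (i - 1)) + s * N j (c i).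
Proof. by rewrite /side_fun /sidept !dot2E !mxE; ring. Qed.

Lemma inP_sidept i s : 0 <= s <= 1 -> inP (sidept i s).
Proof.
move=> /andP[s0 s1] j; rewrite N_sidept.
have := ler_wpM2l s0 (inP_vtx i j).
have s1' : 0 <= 1 - s by rewrite subr_ge0.
have := ler_wpM2l s1' (inP_vtx (i - 1) j).
by rewrite !mulr0; lra.
Qed.

Lemma isproj_P x : inP x -> isproj x x.
Proof.
move=> h; split => // z _; rewrite subrr /skew /cross2 dot2E !mxE.
by rewrite !mul0r !(addr0, subr0) !mulr0 addr0.
Qed.

Lemma isproj_S i s a : 0 <= s <= 1 -> 0 <= a ->
  isproj (sidept i s + a *: e i) (sidept i s).
Proof.
move=> hs a0; split; first exact: inP_sidept.
move=> z /(_ i) hz; rewrite [X in skew X]addrAC subrr add0r skewZl skew_dir.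
have -> : dot (n i) (z - sidept i s) = N i z - N i (sidept i s).
  by rewrite /side_fun !dotBr; ring.
by rewrite N_sidept N_vtx N_vtx_prev !mulr0 addr0 subr0 mulr_ge0_le0.
Qed.

Lemma isproj_C i a b : 0 <= a -> 0 <= b ->
  isproj (c i + (a *: e i + b *: e (i + 1))) (c i).
Proof.
move=> a0 b0; split; first exact: inP_vtx.
move=> z hz; rewrite [X in skew X]addrAC subrr add0r skewDl !skewZl !skew_dir.
have := hz (i + 1); rewrite N_prev addrK; have := hz i; rewrite /side_fun => h1 h2.
have := mulr_ge0_le0 a0 h1; have := mulr_ge0_le0 b0 h2; lra.
Qed.

(** The oblique coordinates are valid in the whole plane; lying in the strip only puts the first one
    in [[0, 1]] and makes the second nonnegative. The same holds for [C_coord] and the sector. *)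
Lemma S_coord i x :
  x = sidept i (f i x / (l i * st)) + (N i x / st) *: e i.
Proof.
have E : cross2 (perp (n i)) (e i) = - st.
  by rewrite crossC cross_dir dot_perp_perp nrm_unit dot_perp; ring.
have E0 : cross2 (perp (n i)) (e i) != 0 by rewrite E oppr_eq0 st_neq0.
have := cramer (x - c (i - 1)) E0; rewrite E crossC -/(ray_fun0 D i x).
have -> : cross2 (perp (n i)) (x - c (i - 1)) = - N i x.
  by rewrite N_prev /cross2 dot2E !coord2E; ring.
move=> h; rewrite /sidept side_eq scalerA -addrA.
rewrite (_ : f i x / _ * _ = - f i x / - st); last first.
  by field; rewrite st_neq0 len_neq0.
rewrite (_ : N i x / st = - N i x / - st); last by field; rewrite st_neq0.
by rewrite -h addrC subrK.
Qed.

Lemma C_coord i x :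
  x = c i + ((- f (i + 1) x / sa i) *: e i + (g i x / sa i) *: e (i + 1)).
Proof.
have E0 : cross2 (e i) (e (i + 1)) != 0 by rewrite cross_dir_next sa_neq0.
have := cramer (x - c i) E0; rewrite cross_dir_next crossC /ray_fun0 addrK /ray_fun1 => <-.
by rewrite addrC subrK.
Qed.

End Pieces.

(** * The folded map *)

Section SupNorm.
Variable R : realType.

Lemma norm_coord n (u : 'rV[R]_n) k : `|u 0 k| <= `|u|.
Proof.
by rewrite [leRHS]/Num.Def.normr /= mx_normrE; exact: (le_bigmax _ _ (0, k)).
Qed.

Lemma norm_leP n (u : 'rV[R]_n) m : 0 <= m -> (forall k, `|u 0 k| <= m) -> `|u| <= m.
Proof.
move=> m0 h; rewrite [leLHS]/Num.Def.normr /= mx_normrE.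
by apply: bigmax_le => // -[i k] _; rewrite ord1.
Qed.

Lemma norm_le_sqrt_dot (u : 'rV[R]_2) t : 0 <= t -> dot u u <= t ^+ 2 -> `|u| <= t.
Proof.
move=> t0; rewrite dot2E -!expr2 => h; apply: norm_leP => // k.
rewrite -(ger0_norm t0) -ler_sqr ?nnegrE // !real_normK ?num_real //.
have h0 := sqr_ge0 (u 0 0); have h1 := sqr_ge0 (u 0 1).
case: k => -[|[|//]] Hk.
- by rewrite (_ : Ordinal Hk = 0); [lra | apply: val_inj].
- by rewrite (_ : Ordinal Hk = 1); [lra | apply: val_inj].
Qed.

(** Comparison of the Euclidean norm with the sup norm; the constant 2 in place of the square root
    of 2 is enough and stays rational. *)
Lemma dot_le_norm (u : 'rV[R]_2) : dot u u <= (2 * `|u|) ^+ 2.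
Proof.
have sq k : u 0 k * u 0 k <= `|u| ^+ 2.
  by rewrite -expr2 -real_normK ?num_real // ler_sqr ?nnegrE // norm_coord.
rewrite dot2E exprMn; have := sq 0; have := sq 1; have := sqr_ge0 `|u|; lra.
Qed.

Lemma cross_le_norm (u v : 'rV[R]_2) : `|u| <= 1 -> `|cross2 u v| <= 2 * `|v|.
Proof.
move=> hu; rewrite /cross2 (le_trans (ler_normB _ _)) // !normrM.
rewrite mulr_natl mulr2n lerD // -[leRHS]mul1r ler_pM ?norm_coord //;
  exact: le_trans (norm_coord _ _) hu.
Qed.

Lemma max_lip (a b a' b' m : R) : `|a - a'| <= m -> `|b - b'| <= m ->
  `|Num.max a b - Num.max a' b'| <= m.
Proof.
rewrite !ler_norml /Num.max => /andP[h1 h2] /andP[h3 h4].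
by case: (ltP a b) => h5; case: (ltP a' b') => h6; apply/andP; split; lra.
Qed.

Lemma min_lip (a b a' b' m : R) : `|a - a'| <= m -> `|b - b'| <= m ->
  `|Num.min a b - Num.min a' b'| <= m.
Proof.
rewrite !ler_norml /Num.min => /andP[h1 h2] /andP[h3 h4].
by case: (ltP a b) => h5; case: (ltP a' b') => h6; apply/andP; split; lra.
Qed.

Definition embed (u : 'rV[R]_2) : 'rV[R]_3 := vec3 (u 0 0) (u 0 1) 0.

Lemma embedD u v : embed (u + v) = embed u + embed v.
Proof. by apply: row3P; rewrite !(coord3E, mxE) /= ?addr0. Qed.

Lemma embedZ t u : embed (t *: u) = t *: embed u.
Proof. by apply: row3P; rewrite !(coord3E, mxE) /= ?mulr0. Qed.

Lemma embedN u : embed (- u) = - embed u.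
Proof. by rewrite -scaleN1r embedZ scaleN1r. Qed.

Lemma norm_embed u : `|embed u| = `|u|.
Proof.
apply/eqP; rewrite eq_le; apply/andP; split.
  apply: norm_leP => // -[[|[|[|//]]] Hk]; rewrite mxE /= ?norm_coord //.
  by rewrite normr0.
apply: norm_leP => // -[[|[|//]] Hk].
- rewrite (_ : Ordinal Hk = 0); last exact: val_inj.
  by rewrite -[u 0 0](vec3_0 _ (u 0 1) 0) norm_coord.
- rewrite (_ : Ordinal Hk = 1); last exact: val_inj.
  by rewrite -[u 0 1](vec3_1 (u 0 0) _ 0) norm_coord.
Qed.

End SupNorm.

Section FoldedMap.
Variables (R : realType) (D : double_line R).
Implicit Types (i j : 'I_4) (u v w x y z : 'rV[R]_2) (s a b t : R).
Local Notation st := (sin (theta D)).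
Local Notation sa i := (sin (angle D i)).
Local Notation c := (vtx D).
Local Notation e := (dir D).

(* [hat i] vanishes at 0 and on the rays [e j], [j != i + 1], and is linear on
   the cones between consecutive rays, with value 1 at [e (i + 1)]. *)
Definition hat i w : R :=
  let l1 := cross2 (e i) w / sa i in
  let l2 := cross2 w (e (i + 1 + 1)) / sa (i + 1) in
  Num.max 0 (if 0 <= cross2 (e i) (e (i + 1 + 1)) then Num.min l1 l2
             else Num.max l1 l2).

Definition cone i a b := a *: e i + b *: e (i + 1).

Lemma cross_cone_l i a b u :
  cross2 (cone i a b) u = a * cross2 (e i) u + b * cross2 (e (i + 1)) u.
Proof. by rewrite crossDl !crossZl. Qed.

Lemma cross_cone_r i a b u :
  cross2 u (cone i a b) = a * cross2 u (e i) + b * cross2 u (e (i + 1)).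
Proof. by rewrite crossDr !crossZr. Qed.

Lemma cross_dir_prev i : cross2 (e i) (e (i + 1 + 1 + 1)) = - sa (i + 1 + 1 + 1).
Proof. by rewrite crossC -[X in cross2 _ (e X)](ord4_add4 i) cross_dir_next. Qed.

(** [l1] and [l2] are the linear functions prescribed on the two cones that meet along [e (i + 1)].
    These cones have a convex union exactly when [K >= 0]; the function that is linear on both is
    then the minimum of [l1] and [l2], and otherwise their maximum. The max/min form makes the
    Lipschitz bound immediate. *)
Lemma hat_cone0 i a b : 0 <= a -> 0 <= b -> hat i (cone i a b) = b.
Proof.
move=> a0 b0; rewrite /hat !(cross_cone_l, cross_cone_r) crossxx !cross_dir_next.
set K := cross2 _ _; have s0 := sa_gt0 D i; have s1 := sa_gt0 D (i + 1).
have -> : (a * 0 + b * sa i) / sa i = b by field; exact: sa_neq0.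
have -> : (a * K + b * sa (i + 1)) / sa (i + 1) = b + a * K / sa (i + 1).
  by field; exact: sa_neq0.
case: ifP => [K0|/negbT]; last rewrite -ltNge => K0.
- have p : 0 <= a * K / sa (i + 1) by rewrite divr_ge0 ?mulr_ge0 // ltW.
  by rewrite min_l ?lerDl // max_r.
- have p : a * K / sa (i + 1) <= 0.
    by rewrite mulr_le0_ge0 ?invr_ge0 ?(ltW s1) // mulr_ge0_le0 // ltW.
  by rewrite [Num.max b _]max_l ?gerDl // max_r.
Qed.

Lemma hat_cone1 i a b : 0 <= a -> 0 <= b -> hat i (cone (i + 1) a b) = a.
Proof.
move=> a0 b0; rewrite /hat !(cross_cone_l, cross_cone_r) crossxx !cross_dir_next.
set K := cross2 _ _; have s0 := sa_gt0 D i; have s1 := sa_gt0 D (i + 1).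
have -> : (a * sa (i + 1) + b * 0) / sa (i + 1) = a by field; exact: sa_neq0.
have -> : (a * sa i + b * K) / sa i = a + b * K / sa i.
  by field; exact: sa_neq0.
case: ifP => [K0|/negbT]; last rewrite -ltNge => K0.
- have p : 0 <= b * K / sa i by rewrite divr_ge0 ?mulr_ge0 // ltW.
  by rewrite min_r ?lerDl // max_r.
- have p : b * K / sa i <= 0.
    by rewrite mulr_le0_ge0 ?invr_ge0 ?(ltW s0) // mulr_ge0_le0 // ltW.
  by rewrite [Num.max _ a]max_r ?gerDl // max_r.
Qed.

Lemma hat_cone2 i a b : 0 <= a -> 0 <= b -> hat i (cone (i + 1 + 1) a b) = 0.
Proof.
move=> a0 b0; rewrite /hat !(cross_cone_l, cross_cone_r) crossxx cross_dir_prev.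
rewrite [cross2 (e (_ + 1 + 1 + 1)) _]crossC cross_dir_next.
set K := cross2 _ _; have s0 := sa_gt0 D i; have s1 := sa_gt0 D (i + 1).
have s2 := sa_gt0 D (i + 1 + 1); have s3 := sa_gt0 D (i + 1 + 1 + 1).
have q : (a * 0 + b * - sa (i + 1 + 1)) / sa (i + 1) <= 0.
  rewrite mulr0 add0r mulrN mulNr oppr_le0 divr_ge0 ?(ltW s1) //.
  by rewrite mulr_ge0 // ltW.
case: ifP => [K0|/negbT]; last rewrite -ltNge => K0.
  by rewrite max_l // ge_min q orbT.
rewrite max_l // ge_max q andbT mulr_le0_ge0 ?invr_ge0 ?(ltW s0) //.
rewrite mulrN subr_le0; apply: (@le_trans _ _ 0); last by rewrite mulr_ge0 // ltW.
by rewrite mulr_ge0_le0 // ltW.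
Qed.

Lemma hat_cone3 i a b : 0 <= a -> 0 <= b -> hat i (cone (i + 1 + 1 + 1) a b) = 0.
Proof.
move=> a0 b0; rewrite /hat !(cross_cone_l, cross_cone_r) ord4_add4 crossxx cross_dir_prev.
rewrite [cross2 (e (_ + 1 + 1 + 1)) _]crossC cross_dir_next.
set K := cross2 _ _; have s0 := sa_gt0 D i; have s1 := sa_gt0 D (i + 1).
have s2 := sa_gt0 D (i + 1 + 1); have s3 := sa_gt0 D (i + 1 + 1 + 1).
have q : (a * - sa (i + 1 + 1 + 1) + b * 0) / sa i <= 0.
  rewrite mulr0 addr0 mulrN mulNr oppr_le0 divr_ge0 ?(ltW s0) //.
  by rewrite mulr_ge0 // ltW.
case: ifP => [K0|/negbT]; last rewrite -ltNge => K0.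
  by rewrite max_l // ge_min q.
rewrite max_l // ge_max q mulr_le0_ge0 ?invr_ge0 ?(ltW s1) //.
rewrite mulrN addrC subr_le0; apply: (@le_trans _ _ 0); last by rewrite mulr_ge0 // ltW.
by rewrite mulr_ge0_le0 // ltW.
Qed.

(** The functions [hat j] are the nodal basis of piecewise linear interpolation on the fan of rays;
    the shift occurs because [hat j] belongs to the ray [j + 1]. *)
Lemma sum_hat_cone (F : 'I_4 -> 'rV[R]_3) i a b : 0 <= a -> 0 <= b ->
  \sum_j hat j (cone i a b) *: F (j + 1) = a *: F i + b *: F (i + 1).
Proof.
move=> a0 b0; rewrite (ord4_sum _ i) hat_cone0 // ord4_add4.
have -> : hat (i + 1 + 1 + 1) (cone i a b) = a.
  by rewrite -[X in cone X](ord4_add4 i) hat_cone1.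
have -> : hat (i + 1 + 1) (cone i a b) = 0.
  by rewrite -[X in cone X](ord4_add4 i) hat_cone2.
have -> : hat (i + 1) (cone i a b) = 0.
  by rewrite -[X in cone X](ord4_add4 i) hat_cone3.
by rewrite !scale0r !addr0 addrC.
Qed.

(** A sum instead of a maximum, as one bound for all [j]: the 2 comes from [cross_le_norm], the
    sines from the denominators in [hat]. *)
Definition hat_lip := \sum_j 2 / sa j.

Lemma le_hat_lip j : 2 / sa j <= hat_lip.
Proof.
rewrite /hat_lip (bigD1 j) //= lerDl; apply: sumr_ge0 => k _.
by rewrite divr_ge0 // ltW // sa_gt0.
Qed.

Lemma norm_dir i : `|e i| <= 1.
Proof. by apply: norm_le_sqrt_dot => //; rewrite dot_dir expr1n. Qed.

Lemma hat_lipschitz i w w' : `|hat i w - hat i w'| <= hat_lip * `|w - w'|.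
Proof.
have K0 : 0 <= hat_lip * `|w - w'|.
  by rewrite mulr_ge0 // (le_trans _ (le_hat_lip i)) // divr_ge0 // ltW // sa_gt0.
have h j u v : `|u| <= 1 ->
    `|cross2 u w / sa j - cross2 u w' / sa j| <= hat_lip * `|w - w'|.
  move=> hu; rewrite -mulrBl -crossNr -crossDr normrM normfV.
  rewrite (gtr0_norm (sa_gt0 D j)) (le_trans _ (ler_wpM2r _ (le_hat_lip j))) //.
  rewrite mulrAC ler_wpM2r ?invr_ge0 ?(ltW (sa_gt0 _ _)) //.
  exact: cross_le_norm.
have h1 := h i (e i) 0 (norm_dir i).
have h2 : `|cross2 w (e (i + 1 + 1)) / sa (i + 1) -
    cross2 w' (e (i + 1 + 1)) / sa (i + 1)| <= hat_lip * `|w - w'|.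
  rewrite ![cross2 _ (e (i + 1 + 1))]crossC !mulNr opprK addrC distrC -normrN opprB.
  by rewrite distrC (h (i + 1) (e (i + 1 + 1)) 0 (norm_dir _)).
rewrite /hat; apply: max_lip; first by rewrite subrr normr0.
by case: ifP => _; [apply: min_lip | apply: max_lip].
Qed.

Definition proj x : 'rV[R]_2 := xget 0 [set y | isproj D x y].

(** Existence needs no minimisation argument: the closed pieces cover the plane, and on each of them
    the projection is explicit, namely the point itself, a point of the side, or a vertex. *)
Lemma isproj_proj x : isproj D x (proj x).
Proof.
apply: (@xgetPex _ 0 [set y | isproj D x y]).
case: (cover D x) => [h|[i [h1 h2 h3]]|[i [h1 h2]]].
- by exists x; apply: isproj_P.
- exists (sidept D i (ray_fun0 D i x / (len D i * st))).
  rewrite /= [X in isproj _ X](S_coord D i).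
  have l0 := len_gt0 D i; have s0 := st_gt0 D.
  apply: isproj_S; last by rewrite divr_ge0 // ltW.
  rewrite divr_ge0 //=; last by rewrite mulr_ge0 // ltW.
  by rewrite ler_pdivrMr ?mulr_gt0 // mul1r fE gerDr.
- exists (c i); rewrite /= [X in isproj _ X](C_coord D i).
  have s0 := sa_gt0 D i.
  by apply: isproj_C; rewrite divr_ge0 ?oppr_ge0 // ltW.
Qed.

Lemma proj_eq x y : isproj D x y -> proj x = y.
Proof. exact: isproj_uniq (isproj_proj x). Qed.

Lemma proj_lipschitz x x' : `|proj x - proj x'| <= 2 / st * `|x - x'|.
Proof.
have s0 := st_gt0 D.
have := isproj_lip (isproj_proj x) (isproj_proj x').
move=> /le_trans /(_ (dot_le_norm _)) h.
apply: norm_le_sqrt_dot; first by rewrite mulr_ge0 // divr_ge0 // ltW.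
rewrite -mulrA mulrCA mulrC exprMn exprVn ler_pdivlMr ?exprn_gt0 //.
by rewrite mulrC.
Qed.

Variable E : 'I_4 -> 'rV[R]_3.

(** Written as the inclusion plus a correction whose coefficients are the small displacements of the
    ray directions, so that the distance to the inclusion can be estimated directly. *)
Definition fold_map x : 'rV[R]_3 :=
  embed x + \sum_j hat j (x - proj x) *: (E (j + 1) - embed (e (j + 1))).

Lemma fold_map_proj x y i a b : isproj D x y -> 0 <= a -> 0 <= b ->
  x = y + cone i a b ->
  fold_map x = embed y + (a *: E i + b *: E (i + 1)).
Proof.
move=> h a0 b0 hx; rewrite /fold_map (proj_eq h) {2}hx [y + _ - _]addrAC subrr add0r.
rewrite (sum_hat_cone (fun i => E i - embed (e i))) // hx embedD -addrA.
rewrite /cone embedD !embedZ !scalerBr; congr (_ + _).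
by rewrite addrACA !subrKC.
Qed.

Lemma fold_map_P x : inP D x -> fold_map x = embed x.
Proof.
move=> h; rewrite (fold_map_proj (i := 0) (a := 0) (b := 0) (isproj_P h)) //.
  by rewrite !scale0r !addr0.
by rewrite /cone !scale0r !addr0.
Qed.

Lemma fold_map_S i s a : 0 <= s <= 1 -> 0 <= a ->
  fold_map (sidept D i s + a *: e i) = embed (sidept D i s) + a *: E i.
Proof.
move=> hs a0; rewrite (fold_map_proj (i := i) (b := 0) (isproj_S D i hs a0) a0) //.
  by rewrite scale0r addr0.
by rewrite /cone scale0r addr0.
Qed.

Lemma fold_map_C i a b : 0 <= a -> 0 <= b ->
  fold_map (c i + cone i a b) = embed (c i) + (a *: E i + b *: E (i + 1)).
Proof. by move=> a0 b0; apply: fold_map_proj => //; apply: isproj_C. Qed.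

Definition fold_lip := hat_lip * (1 + 2 / st).

Lemma fold_lip_gt0 : 0 < fold_lip.
Proof.
have s0 := st_gt0 D; apply: mulr_gt0; last by rewrite ltr_pwDl // divr_ge0 // ltW.
by apply: lt_le_trans (le_hat_lip 0); rewrite divr_gt0 // sa_gt0.
Qed.

(** Each of the four coefficients [hat j (x - proj x)] is [fold_lip]-Lipschitz in [x] and multiplies
    a vector of norm at most [d]; the factor 8 makes the total [4 * fold_lip * d] at most one
    half. *)
Lemma fold_map_near d x x' : 0 <= d -> 8 * fold_lip * d <= 1 ->
  (forall i, `|E i - embed (e i)| <= d) ->
  `|fold_map x - fold_map x' - embed (x - x')| <= `|x - x'| / 2.
Proof.
move=> d0 hd hE.
have hw : `|x - proj x - (x' - proj x')| <= (1 + 2 / st) * `|x - x'|.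
  rewrite (_ : _ - _ = x - x' + (proj x' - proj x)); last first.
    by apply: row2P; rewrite !mxE; ring.
  apply: le_trans (ler_normD _ _) _; rewrite mulrDl mul1r lerD2l distrC.
  exact: proj_lipschitz.
have -> : fold_map x - fold_map x' - embed (x - x') =
  \sum_j (hat j (x - proj x) - hat j (x' - proj x')) *: (E (j + 1) - embed (e (j + 1))).
  rewrite (eq_bigr _ (fun j _ => scalerBl _ _ _)) big_split /= sumrN.
  have cancel_base (p q r r' : 'rV[R]_3) : p + r - (q + r') - (p - q) = r - r'.
    by rewrite (opprD q) (addrACA p r) [p - q + _]addrC addrK.
  by rewrite /fold_map embedD embedN cancel_base.
apply: le_trans (ler_norm_sum _ _ _) _.
apply: (@le_trans _ _ (\sum_(j < 4) fold_lip * `|x - x'| * d)).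
  apply: ler_sum => j _; rewrite normrZ ler_pM //.
  apply: le_trans (hat_lipschitz _ _ _) _.
  rewrite /fold_lip -mulrA ler_wpM2l // ltW //.
  by apply: lt_le_trans (le_hat_lip 0); rewrite divr_gt0 // sa_gt0.
rewrite sumr_const card_ord -mulr_natl ler_pdivlMr //.
have := ler_wpM2r (normr_ge0 (x - x')) hd; rewrite mul1r; apply: le_trans.
by rewrite le_eqVlt; apply/orP; left; apply/eqP; ring.
Qed.

End FoldedMap.

(** * Linear isometries and normals of the folded faces *)

Section Frames.
Variable R : realType.
Implicit Types (u v : 'rV[R]_2) (x y z : 'rV[R]_3) (a b : R).

Lemma dot_cross3_cross3 x y z (w : 'rV[R]_3) :
  dot (cross3 x y) (cross3 z w) = dot x z * dot y w - dot x w * dot y z.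
Proof. by rewrite !dot3E !coord3E; ring. Qed.

Lemma dot_cross3_l x y z :
  dot x (cross3 z (cross3 x y)) = dot x x * dot z y - dot x y * dot z x.
Proof. by rewrite !dot3E !coord3E; ring. Qed.

Lemma dot_cross3_r x y z :
  dot y (cross3 (cross3 x y) z) = dot y y * dot z x - dot x y * dot z y.
Proof. by rewrite !dot3E !coord3E; ring. Qed.

Lemma cross3Zl a x y : cross3 (a *: x) y = a *: cross3 x y.
Proof. by apply: row3P; rewrite !(coord3E, mxE) /=; ring. Qed.

Lemma cross3Zr a x y : cross3 x (a *: y) = a *: cross3 x y.
Proof. by apply: row3P; rewrite !(coord3E, mxE) /=; ring. Qed.

Lemma dot_embed u v : dot (embed u) (embed v) = dot u v.
Proof. by rewrite dot3E dot2E !coord3E; ring. Qed.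

(* The linear map sending [u] to [x] and [v] to [y]. *)
Definition frame_mx u v x y : 'M[R]_(2, 3) :=
  \matrix_(i, j) ((cross2 (delta_mx 0 i) v * x 0 j
                   + cross2 u (delta_mx 0 i) * y 0 j) / cross2 u v).

Section Frame.
Variables (u v : 'rV[R]_2) (x y : 'rV[R]_3).
Hypothesis uv : cross2 u v != 0.
Local Notation B := (frame_mx u v x y).

Lemma mul_frame w :
  w *m B = (cross2 w v / cross2 u v) *: x + (cross2 u w / cross2 u v) *: y.
Proof.
apply/rowP => j; rewrite !mxE !big_ord_recl big_ord0 addr0.
rewrite (_ : lift ord0 ord0 = 1); last exact: val_inj.
rewrite (_ : ord0 = 0); last exact: val_inj.
rewrite !mxE; move: uv; rewrite /cross2 !mxE /= => h.
by field.
Qed.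

Lemma mul_frame_l : u *m B = x.
Proof. by rewrite mul_frame divff // crossxx mul0r scale1r scale0r addr0. Qed.

Lemma mul_frame_r : v *m B = y.
Proof. by rewrite mul_frame divff // crossxx mul0r scale1r scale0r add0r. Qed.

Lemma normal_frame : normal B = (cross2 u v)^-1 *: cross3 x y.
Proof.
by apply: row3P; rewrite /normal !(coord3E, mxE) /=; move: uv;
  rewrite /cross2 !mxE /= => h; field.
Qed.

Lemma frame_isometry : dot x x = dot u u -> dot x y = dot u v ->
  dot y y = dot v v -> B *m B^T = 1%:M.
Proof.
move=> hx hxy hy.
have iso w w' : dot (w *m B) (w' *m B) = dot w w'.
  rewrite [in RHS](cramer w uv) [in RHS](cramer w' uv) !mul_frame.
  by rewrite !(dotDl, dotDr, dotZl, dotZr) (dotC y x) (dotC v u) hx hxy hy.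
apply/matrixP => i j.
have -> : (B *m B^T) i j = dot (row i B) (row j B).
  by rewrite mxE; apply: eq_bigr => k _; rewrite !mxE.
rewrite !rowE iso mxE /dot (bigD1 i) //= big1 ?addr0.
  by rewrite !mxE !eqxx mul1r.
by move=> k ki; rewrite !mxE eqxx (negbTE ki) mul0r.
Qed.

End Frame.

Definition frameP := frame_mx (vec2 1 0) (vec2 0 1) (vec3 1 0 0) (vec3 0 1 0).

Lemma cross_basis : cross2 (vec2 1 0) (vec2 0 1) = 1 :> R.
Proof. by rewrite /cross2 !coord2E; ring. Qed.

Lemma frameP_isometry : frameP *m frameP^T = 1%:M.
Proof.
by apply: frame_isometry; rewrite ?cross_basis ?oner_neq0 //
  dot3E dot2E !coord2E !coord3E; ring.
Qed.

Lemma mul_frameP u : u *m frameP = embed u.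
Proof.
rewrite mul_frame cross_basis ?oner_neq0 // !divr1.
by apply: row3P; rewrite /cross2 !(coord2E, coord3E, mxE) /=; ring.
Qed.

Lemma normal_frameP : normal frameP = vec3 0 0 1.
Proof.
rewrite normal_frame cross_basis ?oner_neq0 // invr1 scale1r.
by apply: row3P; rewrite !coord3E; ring.
Qed.

End Frames.

Section Wings.
Variables (R : realType) (D : double_line R).
Implicit Types (i j : 'I_4) (u v w x y z : 'rV[R]_2).
Local Notation th := (theta D).
Local Notation st := (sin (theta D)).
Local Notation ct := (cos (theta D)).
Local Notation sa i := (sin (angle D i)).
Local Notation ca i := (cos (angle D i)).
Local Notation n := (nrm D).
Local Notation c := (vtx D).
Local Notation e := (dir D).
Variables (m : 'I_4 -> bool) (T : 'I_4 -> R).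
Local Notation C i := (cosw (T i)).
Local Notation S i := (sinw (T i)).

(* [dir i] turned about the side [i] by the angle [2 * atan (T i)]. *)
Definition wing i : 'rV[R]_3 :=
  - ct *: embed (perp (n i))
  + st *: (C i *: embed (n i) + S i *: vec3 0 0 1).

Definition frameS i := frame_mx (e i) (perp (n i)) (wing i) (embed (perp (n i))).
Definition frameC i := frame_mx (e i) (e (i + 1)) (wing i) (wing (i + 1)).

Lemma cross_dir_perp i : cross2 (e i) (perp (n i)) = st.
Proof. by rewrite cross_dir dot_perp_perp nrm_unit dot_perp; ring. Qed.

Lemma dot_up u : dot (embed u) (vec3 0 0 1) = 0.
Proof. by rewrite dot3E !coord3E; ring. Qed.

Lemma dot_wing_embed i v :
  dot (wing i) (embed v) = st * C i * dot (n i) v - ct * dot (perp (n i)) v.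
Proof.
rewrite /wing !(dotDl, dotZl) !dot_embed (dotC (vec3 _ _ _)) dot_up.
by ring.
Qed.

Lemma dot_wing_up i : dot (wing i) (vec3 0 0 1) = st * S i.
Proof.
rewrite /wing !(dotDl, dotZl) !dot_up.
have -> : dot (vec3 0 0 1) (vec3 0 0 1) = 1 :> R by rewrite dot3E !coord3E; ring.
by ring.
Qed.

Lemma dot_wing_wing i j : dot (wing i) (wing j) =
  - ct * dot (wing i) (embed (perp (n j)))
  + st * (C j * dot (wing i) (embed (n j)) + S j * (st * S i)).
Proof. by rewrite {2}/wing !(dotDr, dotZr) dot_wing_up. Qed.

Lemma dot_wing i : dot (wing i) (wing i) = 1.
Proof.
rewrite dot_wing_wing !dot_wing_embed dot_perp_perp dot_perp nrm_unit.
rewrite (dotC (perp _)) dot_perp.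
transitivity (ct ^+ 2 + st ^+ 2 * (C i ^+ 2 + S i ^+ 2)); first by ring.
by rewrite cosw_sinw mulr1 cos2Dsin2.
Qed.

Lemma dot_wing_perp i : dot (wing i) (embed (perp (n i))) = - ct.
Proof. by rewrite dot_wing_embed dot_perp dot_perp_perp nrm_unit; ring. Qed.

Lemma dot_nrm_next i : dot (n (i + 1)) (n i) = ca i.
Proof. by rewrite dot_next nrm_unit dotC dot_perp; ring. Qed.

Lemma dot_nrm_next_perp i : dot (n (i + 1)) (perp (n i)) = sa i.
Proof. by rewrite dot_next dot_perp_perp nrm_unit dot_perp; ring. Qed.

Lemma dot_perp_next_nrm i : dot (perp (n (i + 1))) (n i) = - sa i.
Proof. by rewrite dot_perp_next nrm_unit dotC dot_perp; ring. Qed.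

Lemma dot_wing_perp_prev i :
  dot (wing (i + 1)) (embed (perp (n i))) = st * C (i + 1) * sa i - ct * ca i.
Proof. by rewrite dot_wing_embed dot_nrm_next_perp dot_perp_perp dot_nrm_next. Qed.

Lemma dot_wing_nrm_prev i :
  dot (wing (i + 1)) (embed (n i)) = st * C (i + 1) * ca i + ct * sa i.
Proof. by rewrite dot_wing_embed dot_nrm_next dot_perp_next_nrm mulrN opprK. Qed.

Lemma dot_wing_perp_next i :
  dot (wing i) (embed (perp (n (i + 1)))) = - st * C i * sa i - ct * ca i.
Proof.
rewrite dot_wing_embed (dotC (n i)) dot_perp_next_nrm dot_perp_perp.
by rewrite (dotC (n i)) dot_nrm_next; ring.
Qed.

Lemma dot_wing_nrm_next i :
  dot (wing i) (embed (n (i + 1))) = st * C i * ca i - ct * sa i.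
Proof.
by rewrite dot_wing_embed (dotC (n i)) dot_nrm_next dotC dotC dotC dot_nrm_next_perp.
Qed.

Lemma normal_frameS i :
  normal (frameS i) = C i *: vec3 0 0 1 - S i *: embed (n i).
Proof.
rewrite normal_frame cross_dir_perp ?st_neq0 //.
have nn : n i 0 0 * n i 0 0 + n i 0 1 * n i 0 1 = 1 by rewrite -dot2E nrm_unit.
apply: row3P; rewrite /wing !(coord3E, coord2E, mxE) /=.
- by field; exact: st_neq0.
- by field; exact: st_neq0.
- transitivity (C i * (n i 0 0 * n i 0 0 + n i 0 1 * n i 0 1)).
    by field; exact: st_neq0.
  by rewrite nn; ring.
Qed.

Lemma normal_frameC i :
  normal (frameC i) = (sa i)^-1 *: cross3 (wing i) (wing (i + 1)).
Proof. by rewrite normal_frame cross_dir_next // sa_neq0. Qed.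

Hypothesis hm : forall i, mode_rel (m i) th (angle D i) (T i) (T (i + 1)).

(** The difference of the two sides is [sin theta] times the closing expression, which the mode
    relation annihilates. This is what makes the sector at [c i] fold isometrically. *)
Lemma dot_wing_next i : dot (wing i) (wing (i + 1)) = ca i.
Proof.
have := vertex_closed (theta_range D) (angle_range D i) (hm i).
rewrite dot_wing_wing dot_wing_perp_next dot_wing_nrm_next => h.
apply/eqP; rewrite -subr_eq0; apply/eqP.
rewrite -[ca i in X in _ - X]mul1r -(cos2Dsin2 th) -[RHS](mulr0 st) -h.
by ring.
Qed.

Lemma frameS_isometry i : frameS i *m (frameS i)^T = 1%:M.
Proof.
apply: frame_isometry; rewrite ?cross_dir_perp ?st_neq0 //.
- by rewrite dot_wing dot_dir.
- by rewrite dot_wing_perp dotC dot_perp_dir.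
- by rewrite dot_embed.
Qed.

Lemma dot_dir_next i : dot (e i) (e (i + 1)) = ca i.
Proof.
have h := dot_dir D i; rewrite dir_next.
by rewrite -[RHS]mulr1 -h !dot2E !coord2E; ring.
Qed.

Lemma frameC_isometry i : frameC i *m (frameC i)^T = 1%:M.
Proof.
apply: frame_isometry; rewrite ?cross_dir_next ?sa_neq0 //.
- by rewrite dot_wing dot_dir.
- by rewrite dot_wing_next dot_dir_next.
- by rewrite dot_wing dot_dir.
Qed.

Lemma cos_side i : dot (normal (frameP R)) (normal (frameS i)) = C i.
Proof.
by rewrite normal_frameP normal_frameS dot3E !(coord3E, mxE) /=; ring.
Qed.

Lemma sin_side i :
  dot (embed (perp (n i))) (cross3 (normal (frameS i)) (normal (frameP R))) = S i.
Proof.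
have nn : n i 0 0 * n i 0 0 + n i 0 1 * n i 0 1 = 1 by rewrite -dot2E nrm_unit.
rewrite normal_frameP normal_frameS dot3E !(coord3E, coord2E, mxE) /=.
transitivity (S i * (n i 0 0 * n i 0 0 + n i 0 1 * n i 0 1)); first by ring.
by rewrite nn mulr1.
Qed.

Lemma normal_frameS' i :
  normal (frameS i) = st^-1 *: cross3 (wing i) (embed (perp (n i))).
Proof. by rewrite normal_frame cross_dir_perp // st_neq0. Qed.

(** Opposite creases of a flat-foldable degree-4 vertex have fold angles equal up to sign: the ray
    lies opposite the side [i + 1]. The cosine does not see the sign, so both modes give the same
    value. *)
Lemma cos_left_ray i :
  dot (normal (frameC i)) (normal (frameS i)) = C (i + 1).
Proof.
rewrite normal_frameC normal_frameS' dotZl dotZr dot_cross3_cross3.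
rewrite dot_wing dot_wing_perp dot_wing_perp_prev [dot (wing (i + 1)) _]dotC dot_wing_next.
by field; rewrite sa_neq0 st_neq0.
Qed.

Lemma cos_right_ray i :
  dot (normal (frameS (i + 1))) (normal (frameC i)) = C i.
Proof.
rewrite dotC normal_frameC normal_frameS' dotZl dotZr dot_cross3_cross3.
rewrite dot_wing dot_wing_perp dot_wing_perp_next dot_wing_next.
by field; rewrite sa_neq0 st_neq0.
Qed.

Lemma dot_normal_wing i (v : 'rV[R]_3) :
  dot (normal (frameS i)) v = C i * dot v (vec3 0 0 1) - S i * dot v (embed (n i)).
Proof. by rewrite normal_frameS dotC dotBr !dotZr. Qed.

Lemma dot_normal_wing0 i : dot (normal (frameS i)) (wing i) = 0.
Proof.
rewrite dot_normal_wing dot_wing_up dot_wing_embed nrm_unit dotC dot_perp.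
by ring.
Qed.

(** The sine decides the sign left open by the cosine. The triple product reduces to
    [dot (normal (frameS i)) (wing (i + 1))], because [wing i] is a unit vector orthogonal to the
    normal of its own strip. *)
Lemma sin_left_ray i :
  dot (wing i) (cross3 (normal (frameS i)) (normal (frameC i)))
  = sinw (if m i then - T (i + 1) else T (i + 1)).
Proof.
have := left_ray_sin (theta_range D) (angle_range D i) (hm i) => h.
apply: (mulfI (sa_neq0 D i)); rewrite -h normal_frameC cross3Zr dotZr.
rewrite dot_cross3_l dot_normal_wing0 dot_wing dot_normal_wing.
rewrite dot_wing_up dot_wing_nrm_prev.
by field; rewrite sa_neq0.
Qed.

Lemma sin_right_ray i :
  dot (wing (i + 1)) (cross3 (normal (frameC i)) (normal (frameS (i + 1))))
  = sinw (if m i then T i else - T i).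
Proof.
have := right_ray_sin (theta_range D) (angle_range D i) (hm i) => h.
apply: (mulfI (sa_neq0 D i)); rewrite -h normal_frameC cross3Zl dotZr.
rewrite dot_cross3_r dot_normal_wing0 dot_wing dot_normal_wing.
rewrite dot_wing_up dot_wing_nrm_next.
by field; rewrite sa_neq0.
Qed.

(** The displacement is linear in [C i - 1] and [S i], each at most [2 * |T i|]; the first is in
    fact quadratic in [T i], and [|T i| <= 1] makes it linear. *)
Lemma norm_wing i : `|T i| <= 1 -> `|wing i - embed (e i)| <= 4 * `|T i|.
Proof.
move=> T1.
have -> : wing i - embed (e i) =
    st *: ((C i - 1) *: embed (n i) + S i *: vec3 0 0 1).
  by apply: row3P; rewrite /wing /dir !(coord3E, coord2E, mxE) /=; ring.
have d0 := den_gt0 (T i).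
have d1 : 1 <= 1 + T i ^+ 2 by rewrite lerDl sqr_ge0.
have hS : `|S i| <= 2 * `|T i|.
  rewrite /sinw normrM normfV (gtr0_norm d0) normrM ger0_norm //.
  by rewrite ler_pdivrMr // ler_peMr // mulr_ge0.
have hC : `|C i - 1| <= 2 * `|T i|.
  have -> : C i - 1 = - (2 * T i ^+ 2 / (1 + T i ^+ 2)).
    by rewrite /cosw; field; rewrite den_neq0.
  rewrite normrN normrM normfV (gtr0_norm d0) normrM ger0_norm // normrX.
  rewrite ler_pdivrMr //.
  apply: (@le_trans _ _ (2 * `|T i|)); last by rewrite ler_peMr // mulr_ge0.
  by rewrite ler_wpM2l // expr2 ler_piMr.
have hk : `|vec3 0 0 1 : 'rV[R]_3| <= 1.
  by apply: norm_leP => // -[[|[|[|//]]] Hk]; rewrite mxE /= ?normr0 ?normr1.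
have hn : `|embed (n i)| <= 1.
  by rewrite norm_embed; apply: norm_le_sqrt_dot => //; rewrite nrm_unit expr1n.
rewrite normrZ (le_trans (@ler_piMl _ _ _ _ _)) //.
  by rewrite (gtr0_norm (st_gt0 D)) sin_le1.
apply: le_trans (ler_normD _ _) _.
rewrite [X in X + _]normrZ [X in _ + X]normrZ.
apply: le_trans (lerD (ler_pM _ _ hC hn) (ler_pM _ _ hS hk)) _ => //.
by rewrite !mulr1; lra.
Qed.

Lemma congruentP x : inP D x -> fold_map D wing x = 0 + x *m frameP R.
Proof. by move=> h; rewrite fold_map_P // mul_frameP add0r. Qed.

Lemma congruentS i x : inS D i x ->
  fold_map D wing x
  = (embed (c (i - 1)) - c (i - 1) *m frameS i) + x *m frameS i.
Proof.
move=> [h1 h2 h3]; have l0 := len_gt0 D i; have s0 := st_gt0 D.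
have E0 : cross2 (e i) (perp (n i)) != 0 by rewrite cross_dir_perp st_neq0.
rewrite (S_coord D i x) fold_map_S; first last.
- by rewrite divr_ge0 // ltW.
- rewrite divr_ge0 //=; last by rewrite mulr_ge0 // ltW.
  by rewrite ler_pdivrMr ?mulr_gt0 // mul1r fE gerDr.
rewrite /sidept side_eq !mulmxDl -!scalemxAl.
rewrite mul_frame_l // mul_frame_r // embedD !embedZ.
by rewrite -!addrA; congr (_ + _); rewrite !addrA addNr add0r.
Qed.

Lemma congruentC i x : inC D i x ->
  fold_map D wing x = (embed (c i) - c i *m frameC i) + x *m frameC i.
Proof.
move=> [h1 h2]; have s0 := sa_gt0 D i.
have E0 : cross2 (e i) (e (i + 1)) != 0 by rewrite cross_dir_next sa_neq0.
rewrite (C_coord D i x) fold_map_C; first last.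
- by rewrite divr_ge0 // ltW.
- by rewrite divr_ge0 ?oppr_ge0 // ltW.
rewrite !mulmxDl -!scalemxAl mul_frame_l // mul_frame_r //.
by rewrite [RHS]addrA subrK.
Qed.

End Wings.

(** * Faces and fold angles *)

Section ConvexPieces.
Variable R : realType.
Implicit Types (p u v w x y b o : 'rV[R]_2) (h : 'rV[R]_2 * 'rV[R]_2)
  (s : seq ('rV[R]_2 * 'rV[R]_2)) (t r : R).

(* A half-plane is given by an inward normal and a point of its boundary. *)
Definition opiece s : set 'rV[R]_2 :=
  [set x | forall h, h \in s -> 0 < dot h.1 (x - h.2)].
Definition cpiece s : set 'rV[R]_2 :=
  [set x | forall h, h \in s -> 0 <= dot h.1 (x - h.2)].

Lemma opiece_cons h s :
  opiece (h :: s) = [set x | 0 < dot h.1 (x - h.2)] `&` opiece s.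
Proof.
apply/seteqP; split => x /=.
- move=> H; split; first by apply: H; rewrite mem_head.
  by move=> k ks; apply: H; rewrite inE ks orbT.
- by move=> [H1 H2] k; rewrite inE => /predU1P[->//|/H2].
Qed.

Lemma cpiece_cons h s :
  cpiece (h :: s) = [set x | 0 <= dot h.1 (x - h.2)] `&` cpiece s.
Proof.
apply/seteqP; split => x /=.
- move=> H; split; first by apply: H; rewrite mem_head.
  by move=> k ks; apply: H; rewrite inE ks orbT.
- by move=> [H1 H2] k; rewrite inE => /predU1P[->//|/H2].
Qed.

Lemma continuous_dot p b : continuous (fun x => dot p (x - b)).
Proof.
have -> : (fun x => dot p (x - b)) =
    (fun x => p 0 0 * (x 0 0 - b 0 0) + p 0 1 * (x 0 1 - b 0 1)).
  by apply/funext => x; rewrite dot2E !mxE.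
have H k : continuous (fun x : 'rV[R]_2 => p 0 k * (x 0 k - b 0 k)).
  move=> x; apply: (@continuousM _ _ (fun=> p 0 k) (fun x : 'rV[R]_2 => x 0 k - b 0 k)).
    exact: cst_continuous.
  apply: (@continuousB _ _ _ (fun x : 'rV[R]_2 => x 0 k) (fun=> b 0 k)).
    exact: coord_continuous.
  exact: cst_continuous.
by move=> x; apply: (@continuousD _ _ _ (fun x : 'rV[R]_2 => p 0 0 * (x 0 0 - b 0 0)));
  exact: H.
Qed.

Lemma open_opiece s : open (opiece s).
Proof.
elim: s => [|h s IH].
  by rewrite (_ : opiece [::] = setT); [exact: openT | apply/seteqP; split].
rewrite opiece_cons; apply: openI => //.
apply: (@open_comp _ _ (fun x => dot h.1 (x - h.2)) [set t | 0 < t]).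
  by move=> x _; exact: continuous_dot.
exact: open_gt.
Qed.

Lemma closed_cpiece s : closed (cpiece s).
Proof.
elim: s => [|h s IH].
  by rewrite (_ : cpiece [::] = setT); [exact: closedT | apply/seteqP; split].
rewrite cpiece_cons; apply: closedI => //.
apply: (@preimage_closed _ _ (fun x => dot h.1 (x - h.2)) [set t | 0 <= t]).
  by move=> x _; exact: continuous_dot.
exact: closed_ge.
Qed.

Definition convex_subset (B : set 'rV[R]_2) :=
  forall x y t, B x -> B y -> 0 <= t <= 1 -> B (x + t *: (y - x)).

Lemma convex_opiece s : convex_subset (opiece s).
Proof.
move=> x y t Bx By /andP[t0 t1] h hs.
have hx := Bx h hs; have hy := By h hs.
have -> : dot h.1 (x + t *: (y - x) - h.2) =
    (1 - t) * dot h.1 (x - h.2) + t * dot h.1 (y - h.2).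
  by rewrite !(dotDr, dotNr, dotZr); ring.
have [->|tn0] := eqVneq t 0; first by rewrite subr0 mul1r mul0r addr0.
apply: ltr_wpDl; first by rewrite mulr_ge0 ?subr_ge0 // ltW.
by rewrite mulr_gt0 // lt_neqAle eq_sym tn0.
Qed.

Lemma dot_segment u v t : dot (u + t *: (v - u)) (u + t *: (v - u)) =
  (1 - t) * dot u u + t * dot v v - t * (1 - t) * dot (v - u) (v - u).
Proof. by rewrite !dot2E !mxE; ring. Qed.

Lemma segment_shift x y o t : x + t *: (y - x) - o = x - o + t *: (y - o - (x - o)).
Proof. by apply: row2P; rewrite !mxE; ring. Qed.

Lemma convex_disk o r : 0 <= r -> convex_subset (disk o r).
Proof.
move=> r0 x y t; rewrite /disk /= !enorm_le // => hx hy /andP[t0 t1].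
rewrite segment_shift dot_segment.
have t1' : 0 <= 1 - t by rewrite subr_ge0.
have := ler_wpM2l t1' hx; have := ler_wpM2l t0 hy.
have := mulr_ge0 (mulr_ge0 t0 t1') (dot_ge0 (y - o - (x - o))); lra.
Qed.

Lemma open_segment_disk o r x y z : 0 <= r -> open_disk o r x -> disk o r y ->
  open_segment x y z -> open_disk o r z.
Proof.
move=> r0; rewrite /open_disk /disk /= !(enorm_le, enorm_lt) // => hx hy [t].
rewrite /= in_itv /= => /andP[t0 t1] <-; rewrite segment_shift dot_segment.
have t1' : 0 < 1 - t by rewrite subr_gt0.
have := ler_wpM2l (ltW t0) hy.
have : (1 - t) * dot (x - o) (x - o) < (1 - t) * r ^+ 2 by rewrite ltr_pM2l.
have := mulr_ge0 (mulr_ge0 (ltW t0) (ltW t1')) (dot_ge0 (y - o - (x - o))); lra.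
Qed.

Lemma convexI (A B : set 'rV[R]_2) :
  convex_subset A -> convex_subset B -> convex_subset (A `&` B).
Proof.
by move=> hA hB x y t [Ax Bx] [Ay By] ht; split; [exact: hA | exact: hB].
Qed.

Lemma convex_connected (B : set 'rV[R]_2) x : convex_subset B -> B x -> connected B.
Proof.
move=> hB Bx.
have -> : B = \bigcup_(y in B) [set x + t *: (y - x) | t in `[0, 1]].
  apply/seteqP; split => [y By|z [y By] [t]].
    exists y => //; exists 1; last by rewrite scale1r addrC subrK.
    by rewrite /= in_itv /= ler01 lexx.
  by rewrite /= in_itv /= => ht <-; apply: hB.
apply: bigcup_connected.
  exists x => y By /=; exists 0; last by rewrite scale0r addr0.
  by rewrite /= in_itv /= lexx ler01.
move=> y By; apply: connected_continuous_connected.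
  exact: segment_connected.
apply: continuous_subspaceT => t.
by apply: cvgD; [exact: cvg_cst | apply: cvgZr_tmp; exact: cvg_id].
Qed.

(** The hypotheses make [A] meet [O] and [K] in the same set, which is therefore open and closed in
    [A]; being connected, it is a whole component. *)
Lemma clopen_component (A O K : set 'rV[R]_2) x :
  open O -> closed K -> O `<=` K -> A `&` K `<=` O -> connected (A `&` O) ->
  A x -> O x -> connected_component A x = A `&` O.
Proof.
move=> oO cK OK AKO cAO Ax Ox; apply/seteqP; split; last first.
  by apply: connected_component_max => // y [].
have sub := @connected_component_sub _ A x.
suff <- : connected_component A x `&` O = connected_component A x.
  by move=> y [/sub Ay Oy].
have H := @component_connected _ A x; apply: H.
- by exists x; split => //; apply: connected_component_refl.
- by exists O.
- exists K => //; apply/seteqP; split => y [hy hy'].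
    by split => //; apply: OK.
  by split => //; apply: AKO; split => //; apply: sub.
Qed.

Lemma near0_pos (a m : R) : 0 < a \/ (a = 0 /\ 0 < m) ->
  \forall eps \near 0^'+, 0 < a + eps * m.
Proof.
case=> [a0|[-> m0]]; last first.
  by near=> eps; rewrite add0r mulr_gt0.
near=> eps.
have e0 : 0 < eps by [].
have : eps * (1 + `|m|) < a.
  rewrite -ltr_pdivlMr; last by rewrite ltr_pwDl.
  by near: eps; apply: nbhs_right_lt; rewrite divr_gt0 // ltr_pwDl.
rewrite mulrDr mulr1 => h1.
have : - (eps * m) <= eps * `|m|.
  by rewrite -mulrN ler_pM2l // ler_normr lexx orbT.
lra.
Unshelve. all: by end_near. Qed.

Lemma near_opiece s x w :
  (forall h, h \in s -> 0 < dot h.1 (x - h.2) \/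
     (dot h.1 (x - h.2) = 0 /\ 0 < dot h.1 w)) ->
  \forall eps \near 0^'+, opiece s (x + eps *: w).
Proof.
elim: s => [|h s IH] H; first by near=> eps.
have h1 : \forall eps \near 0^'+, opiece s (x + eps *: w).
  by apply: IH => k ks; apply: H; rewrite inE ks orbT.
have h2 := near0_pos (H h (mem_head _ _)).
near=> eps; rewrite opiece_cons; split; last by near: eps.
rewrite /= (_ : dot _ _ = dot h.1 (x - h.2) + eps * dot h.1 w); first by near: eps.
by rewrite !(dotDr, dotNr, dotZr); ring.
Unshelve. all: by end_near. Qed.

Lemma near_disk o r x w : 0 <= r -> open_disk o r x ->
  \forall eps \near 0^'+, disk o r (x + eps *: w).
Proof.
move=> r0; rewrite /open_disk /= enorm_lt // => hx.
have h : \forall eps \near 0^'+,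
    0 < r ^+ 2 - dot (x - o) (x - o) + eps * - (2 * dot (x - o) w + dot w w).
  by apply: near0_pos; left; rewrite subr_gt0.
near=> eps; rewrite /disk /= enorm_le //.
(* For [eps < 1] the quadratic term is bounded by [eps * dot w w], which the affine function above
   already includes. *)
have e1 : eps < 1 by near: eps; apply: nbhs_right_lt.
have e0 : 0 < eps by [].
have : 0 < r ^+ 2 - dot (x - o) (x - o) + eps * - (2 * dot (x - o) w + dot w w).
  by near: eps.
have -> : dot (x + eps *: w - o) (x + eps *: w - o) =
   dot (x - o) (x - o) + eps * (2 * dot (x - o) w) + eps * (eps * dot w w).
  by rewrite !dot2E !mxE; ring.
have : eps * (eps * dot w w) <= eps * dot w w.
  by rewrite ler_pM2l // ler_piMl ?dot_ge0 // ltW.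
lra.
Unshelve. all: by end_near. Qed.

End ConvexPieces.

(** * Lipschitz perturbations of the inclusion *)

Section Homeomorphism.
Variable R : realType.

Lemma lipschitz_cvg n k (A : set 'rV[R]_n) (h : 'rV[R]_n -> 'rV[R]_k) (L : R) :
  0 < L -> (forall x y, A x -> A y -> `|h x - h y| <= L * `|x - y|) ->
  {within A, continuous h}.
Proof.
move=> L0 hL; apply/subspace_continuousP => x Ax.
apply/cvgrPdist_lt => eps e0; rewrite near_withinE.
near=> y => Ay; apply: le_lt_trans (hL _ _ Ax Ay) _.
rewrite mulrC -ltr_pdivlMr //; near: y.
have : (fun y : 'rV[R]_n => y) @ x --> x by [].
by move=> /cvgrPdist_lt; apply; rewrite divr_gt0.
Unshelve. all: by end_near. Qed.

Lemma bilipschitz_homeo n k (A : set 'rV[R]_n) (h : 'rV[R]_n -> 'rV[R]_k) (L M : R) :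
  0 < L -> 0 < M ->
  (forall x y, A x -> A y -> `|h x - h y| <= L * `|x - y|) ->
  (forall x y, A x -> A y -> `|x - y| <= M * `|h x - h y|) ->
  homeomorphic_onto_image A h.
Proof.
move=> L0 M0 hL hM; split; first exact: lipschitz_cvg L0 hL.
pose q z := xget 0 [set x | A x /\ h x = z].
have qK x : A x -> q (h x) = x.
  move=> Ax; have := @xgetI _ 0 [set y | A y /\ h y = h x] x (conj Ax erefl).
  rewrite -/(q (h x)) => -[Aq hq]; apply: subr0_eq.
  apply/eqP; rewrite -normr_le0; apply: le_trans (hM _ _ Aq Ax) _.
  by rewrite hq subrr normr0 mulr0.
exists q; split; last by move=> x; rewrite inE => /qK.
apply: (lipschitz_cvg M0) => _ _ [x Ax <-] [y Ay <-]; rewrite !qK //.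
exact: hM.
Qed.

(** Since [embed] preserves the sup norm, the triangle inequality bounds the stretching of [h]
    between 1/2 and 3/2, so 2 serves for both Lipschitz constants. *)
Lemma near_isometry_homeo (A : set 'rV[R]_2) (h : 'rV[R]_2 -> 'rV[R]_3) :
  (forall x y, `|h x - h y - embed (x - y)| <= `|x - y| / 2) ->
  homeomorphic_onto_image A h.
Proof.
move=> H; apply: (@bilipschitz_homeo _ _ _ _ 2 2) => // x y _ _.
- have := H x y; have := ler_normD (h x - h y - embed (x - y)) (embed (x - y)).
  by rewrite subrK norm_embed; have := normr_ge0 (x - y); lra.
- have := H x y; have := ler_normB (h x - h y) (h x - h y - embed (x - y)).
  by rewrite subKr norm_embed; lra.
Qed.

End Homeomorphism.

(** * Identification of the faces *)

Section Faces.
Variables (R : realType) (D : double_line R) (C : crease_pattern R dl_crease).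
Variables (o : 'rV[R]_2) (r : R).
Implicit Types (i j k : 'I_4) (x y w : 'rV[R]_2) (a t : R) (b : bool).
Local Notation st := (sin (theta D)).
Local Notation sa i := (sin (angle D i)).
Local Notation n := (nrm D).
Local Notation c := (vtx D).
Local Notation l := (len D).
Local Notation e := (dir D).
Local Notation N := (side_fun D).
Local Notation f := (ray_fun0 D).
Local Notation g := (ray_fun1 D).

Hypothesis region_disk : region C = disk o r.
Hypothesis vtx_open : forall i, open_disk o r (c i).
Hypothesis side_ends : forall i,
  crease_src C (side i) = c (i - 1) /\ crease_dst C (side i) = c i.
Hypothesis ray_segment : forall i (b : bool),
  let base := if b then c i else c (i - 1) in
  crease_src C (ray i b) = base /\
  segment (crease_src C (ray i b)) (crease_dst C (ray i b)) =
    half_line base (e i) `&` disk o r.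

Definition base i (b : bool) := if b then c i else c (i - 1).

Lemma r_ge0 : 0 <= r.
Proof. by apply: le_trans (ltW (vtx_open 0)); exact: enorm_ge0. Qed.

Lemma crease_side i t : 0 <= t <= 1 -> creases C (sidept D i t).
Proof.
move=> ht; exists (side i) => //=; have [-> ->] := side_ends i.
by exists t => //=; rewrite in_itv.
Qed.

Lemma crease_ray i b a : 0 <= a -> disk o r (base i b + a *: e i) ->
  creases C (base i b + a *: e i).
Proof.
move=> a0 hd; exists (ray i b) => //=; have [_ ->] := ray_segment i b.
by split => //; exists a => //=; rewrite in_itv /= a0.
Qed.

Lemma creaseP x : creases C x ->
  (exists i t, 0 <= t <= 1 /\ x = sidept D i t) \/
  (exists i b a, 0 <= a /\ x = base i b + a *: e i).
Proof.
move=> [[i|[i b]] _ /=].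
  have [] := side_ends i; rewrite /side => -> -> [t /= ht <-]; left.
  by exists i, t; split => //; move: ht; rewrite in_itv.
have [_] := ray_segment i b; rewrite /ray => -> [[a /= ha <-] _]; right.
by exists i, b, a; split => //; move: ha; rewrite in_itv /= andbT.
Qed.

Definition halfP := [seq (- n i, c i) | i <- enum 'I_4].
Definition halfS i := [:: (n i, c i); (perp (e i), c (i - 1)); (- perp (e i), c i)].
Definition halfC i := [:: (perp (e i), c i); (- perp (e (i + 1)), c i)].

Lemma dotNl (u v : 'rV[R]_2) : dot (- u) v = - dot u v.
Proof. by rewrite dotC dotNr dotC. Qed.

Lemma dot_perp_cross (u v : 'rV[R]_2) : dot (perp u) v = cross2 u v.
Proof. by rewrite dot2E /cross2 !coord2E; ring. Qed.

Lemma opieceP x : opiece halfP x <-> forall j, N j x < 0.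
Proof.
split=> [H j|H h /mapP[j _ ->]] /=; last by rewrite dotNl oppr_gt0 H.
have := H (- n j, c j); rewrite /= dotNl oppr_gt0; apply.
by apply/mapP; exists j => //; rewrite mem_enum.
Qed.

Lemma cpieceP x : cpiece halfP x <-> inP D x.
Proof.
split=> [H j|H h /mapP[j _ ->]] /=; last by rewrite dotNl oppr_ge0 H.
have := H (- n j, c j); rewrite /= dotNl oppr_ge0; apply.
by apply/mapP; exists j => //; rewrite mem_enum.
Qed.

Lemma opieceS i x : opiece (halfS i) x <-> [/\ 0 < N i x, 0 < f i x & g i x < 0].
Proof.
rewrite /ray_fun0 /ray_fun1 -!dot_perp_cross; split=> [H|[h1 h2 h3] h].
  have := H (n i, c i); have := H (perp (e i), c (i - 1)).
  have := H (- perp (e i), c i); rewrite /= dotNl oppr_gt0 !inE !eqxx !orbT /=.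
  by move=> h3 h2 h1; split; [apply: h1 | apply: h2 | apply: h3].
by rewrite !inE => /or3P[] /eqP -> /=; rewrite ?dotNl ?oppr_gt0.
Qed.

Lemma cpieceS i x : cpiece (halfS i) x <-> inS D i x.
Proof.
rewrite /inS /ray_fun0 /ray_fun1 -!dot_perp_cross; split=> [H|[h1 h2 h3] h].
  have := H (n i, c i); have := H (perp (e i), c (i - 1)).
  have := H (- perp (e i), c i); rewrite /= dotNl oppr_ge0 !inE !eqxx !orbT /=.
  by move=> h3 h2 h1; split; [apply: h1 | apply: h2 | apply: h3].
by rewrite !inE => /or3P[] /eqP -> /=; rewrite ?dotNl ?oppr_ge0.
Qed.

Lemma opieceC i x : opiece (halfC i) x <-> 0 < g i x /\ f (i + 1) x < 0.
Proof.
rewrite /ray_fun0 /ray_fun1 addrK -!dot_perp_cross; split=> [H|[h1 h2] h].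
  have := H (perp (e i), c i); have := H (- perp (e (i + 1)), c i).
  rewrite /= dotNl oppr_gt0 !inE !eqxx !orbT /=.
  by move=> h2 h1; split; [apply: h1 | apply: h2].
by rewrite !inE => /orP[] /eqP -> /=; rewrite ?dotNl ?oppr_gt0.
Qed.

Lemma cpieceC i x : cpiece (halfC i) x <-> inC D i x.
Proof.
rewrite /inC /ray_fun0 /ray_fun1 addrK -!dot_perp_cross; split=> [H|[h1 h2] h].
  have := H (perp (e i), c i); have := H (- perp (e (i + 1)), c i).
  rewrite /= dotNl oppr_ge0 !inE !eqxx !orbT /=.
  by move=> h2 h1; split; [apply: h1 | apply: h2].
by rewrite !inE => /orP[] /eqP -> /=; rewrite ?dotNl ?oppr_ge0.
Qed.

(** What [clopen_component] requires: off the creases the closed half-plane conditions become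
    strict, and the strict ones avoid every crease. *)
Definition separated_piece s :=
  (forall x, disk o r x -> ~ creases C x -> cpiece s x -> opiece s x) /\
  (forall x, opiece s x -> ~ creases C x).

Lemma ord4_neq i : [/\ i != i - 1, i != i - 1 - 1, i - 1 != i + 1 & i - 1 != i + 1 - 1].
Proof. by elim/ord4_ind: i; split. Qed.

Lemma N_vtx_lt0 i : N (i - 1) (c i) < 0 /\ N (i + 1) (c (i - 1)) < 0.
Proof. by have [h1 h2 h3 h4] := ord4_neq i; split; apply: vtx_convex. Qed.

Lemma vtx_N0 i j : N i (c j) = 0 -> j = i - 1 \/ j = i.
Proof.
move=> h; have [->|h1] := eqVneq j (i - 1); first by left.
have [->|h2] := eqVneq j i; first by right.
by have := vtx_convex D h1 h2; rewrite -/(N i (c j)) h ltxx.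
Qed.

Lemma sidept_isproj i t : 0 <= t <= 1 -> isproj D (sidept D i t) (sidept D i t).
Proof. by move=> ht; apply: isproj_P; apply: inP_sidept. Qed.

Lemma ray_isproj i b a : 0 <= a -> isproj D (base i b + a *: e i) (base i b).
Proof.
move=> a0; case: b => /=.
  have := @isproj_C _ D i a 0 a0 (lexx 0); by rewrite scale0r addr0.
by have := @isproj_C _ D (i - 1) 0 a (lexx 0) a0; rewrite scale0r add0r subrK.
Qed.

Lemma base_vtx i b : exists j, base i b = c j.
Proof. by case: b; [exists i | exists (i - 1)]. Qed.

Lemma f_ray i x a : f i (x + a *: e i) = f i x.
Proof. by rewrite /ray_fun0 !(crossxx, crossZr, crossNr, crossDr); ring. Qed.

Lemma g_ray i x a : g i (x + a *: e i) = g i x.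
Proof. by rewrite /ray_fun1 !(crossxx, crossZr, crossNr, crossDr); ring. Qed.

Lemma N_ray i x a : N i (x + a *: e i) = N i x + a * st.
Proof. by rewrite /side_fun !(dot_nrm_dir, dotZr, dotNr, dotDr); ring. Qed.

Lemma g_vtx i : g i (c i) = 0.
Proof. by rewrite /ray_fun1 subrr cross_dir !dot2E !mxE; ring. Qed.

Lemma f_vtx i : f i (c (i - 1)) = 0.
Proof. by rewrite /ray_fun0 subrr cross_dir !dot2E !mxE; ring. Qed.

Lemma vtx_inj i j : c i = c j -> i = j.
Proof.
move=> h; have : N j (c i) = 0 by rewrite h N_vtx.
move=> /vtx_N0[] // hi; have := side_eq D j; rewrite -hi h subrr => E.
have : dot (0 : 'rV[R]_2) (perp (n j)) = l j by rewrite E dotZl dot_perp_perp nrm_unit mulr1.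
by rewrite dot2E !mxE !mul0r addr0 => /eqP; rewrite eq_sym (negbTE (len_neq0 D j)).
Qed.

(** A point of a side projects to itself and a point of a ray to the base of the ray. If such a
    point lay in an open piece, uniqueness would match this with the projection prescribed by the
    piece and contradict a strict inequality. The same comparison serves the strips and the
    sectors. *)
Lemma separatedP : separated_piece halfP.
Proof.
split=> x; last first.
  rewrite opieceP => H /creaseP[[i [t [ht hx]]]|[i [b [a [a0 hx]]]]].
    by have := H i; rewrite hx N_sidept N_vtx_prev N_vtx !mulr0 addr0 ltxx.
  have h := ray_isproj i b a0; rewrite -hx in h.
  have h' : isproj D x x by apply: isproj_P => j; apply: ltW.
  have [j hj] := base_vtx i b; have := H j.
  by rewrite (isproj_uniq h' h) hj N_vtx ltxx.
move=> hd hc /cpieceP H; apply/opieceP => i; rewrite lt_neqAle H andbT.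
apply/negP => /eqP Ni; apply: hc; have := S_coord D i x.
rewrite Ni mul0r scale0r addr0; set t := _ / _ => hx.
(* The neighbouring sides confine [t] to [[0, 1]]: [N (i - 1)] vanishes at [c (i - 1)] and is
   negative at [c i], while [N (i + 1)] vanishes at [c i] and is negative at [c (i - 1)]. *)
rewrite hx; apply: crease_side; have [h1 h2] := N_vtx_lt0 i.
have := H (i - 1); have := H (i + 1); rewrite hx !N_sidept N_vtx.
have -> : N (i + 1) (c i) = 0 by rewrite -[X in c X](addrK 1 i) N_vtx_prev.
rewrite !mulr0 addr0 add0r.
by rewrite !nmulr_lle0 // subr_ge0 => -> ->.
Qed.

Lemma separatedS i : separated_piece (halfS i).
Proof.
have l0 := len_gt0 D i; have s0 := st_gt0 D.
have ls0 : 0 < l i * st by rewrite mulr_gt0.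
split=> x; last first.
  rewrite opieceS => -[h1 h2 h3] /creaseP[[k [t [ht hx]]]|[k [b [a [a0 hx]]]]].
    by have := inP_sidept D k ht i; rewrite -hx leNgt h1.
  have := S_coord D i x; set t := _ / _; set b' := _ / _ => hx'.
  have ht : 0 <= t <= 1.
    rewrite divr_ge0 ?(ltW h2) ?(ltW ls0) //=.
    by rewrite ler_pdivrMr // mul1r fE gerDr ltW.
  have hb : 0 <= b' by rewrite divr_ge0 ?(ltW h1) ?(ltW s0).
  have p1 := isproj_S D i ht hb; rewrite -hx' in p1.
  have p2 := ray_isproj k b a0; rewrite -hx in p2.
  have [j hj] := base_vtx k b; have E := isproj_uniq p1 p2; rewrite hj in E.
  have := N_sidept D i i t; rewrite E N_vtx N_vtx_prev !mulr0 addr0 => Nj.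
  move: h2 h3; rewrite hx' f_ray g_ray E.
  by case: (vtx_N0 Nj) => ->; rewrite ?f_vtx ?g_vtx ltxx.
move=> hd hc /cpieceS[h1 h2 h3].
have hx := S_coord D i x.
have a0 : 0 <= N i x / st by rewrite divr_ge0 // ltW.
apply/opieceS; split; rewrite lt_neqAle ?h1 ?h2 ?h3 andbT; apply/negP => /eqP E;
  apply: hc.
- rewrite hx -E mul0r scale0r addr0; apply: crease_side.
  rewrite divr_ge0 ?(ltW ls0) //=.
  by rewrite ler_pdivrMr // mul1r fE gerDr.
- move: hx; rewrite -E mul0r /sidept scale0r addr0 => hx; rewrite hx.
  by apply: (@crease_ray i false) => //; rewrite -hx.
- move: hx; rewrite fE E add0r divff ?(gt_eqF ls0) // /sidept scale1r addrC.
  rewrite [_ + (c i - _)]addrC subrK addrC => hx; rewrite hx.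
  by apply: (@crease_ray i true) => //; rewrite -hx.
Qed.

Lemma separatedC i : separated_piece (halfC i).
Proof.
have s0 := sa_gt0 D i.
split=> x; last first.
  rewrite opieceC => -[h1 h2].
  have hx' := C_coord D i x.
  have p1 : isproj D x (c i).
    rewrite [X in isproj _ X]hx'; apply: isproj_C.
      by rewrite divr_ge0 ?oppr_ge0 // ltW.
    by rewrite divr_ge0 // ltW.
  move=> /creaseP[[k [t [ht hx]]]|[k [b [a [a0 hx]]]]].
    have p2 := sidept_isproj k ht; rewrite -hx in p2.
    by move: h1; rewrite (isproj_uniq p2 p1) g_vtx ltxx.
  have p2 := ray_isproj k b a0; rewrite -hx in p2.
  have E := isproj_uniq p1 p2.
  case: b E hx {p2} => /= /vtx_inj E hx.
    by move: h1; rewrite hx -E g_ray g_vtx ltxx.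
  by move: h2; rewrite E subrK hx f_ray f_vtx ltxx.
move=> hd hc /cpieceC[h1 h2].
have hx := C_coord D i x.
apply/opieceC; split; rewrite lt_neqAle ?h1 ?h2 andbT; apply/negP => /eqP E;
  apply: hc.
- move: hx; rewrite -E mul0r scale0r addr0 => hx; rewrite hx.
  apply: (@crease_ray i true); rewrite -?hx //.
  by rewrite divr_ge0 ?oppr_ge0 // ltW.
- move: hx; rewrite E oppr0 mul0r scale0r add0r -[X in c X](addrK 1 i) => hx; rewrite hx.
  apply: (@crease_ray (i + 1) false); rewrite -?hx //.
  by rewrite divr_ge0 // ltW.
Qed.

Lemma piece_component s x : separated_piece s -> disk o r x -> opiece s x ->
  connected_component (region C `\` creases C) x = disk o r `&` opiece s.
Proof.
move=> [h1 h2] dx ox; rewrite region_disk.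
have E : (disk o r `\` creases C) `&` opiece s = disk o r `&` opiece s.
  apply/seteqP; split => y; first by move=> [[]].
  by move=> [dy oy]; split=> //; split => //; exact: h2.
rewrite -E; apply: (clopen_component (K := cpiece s)).
- exact: open_opiece.
- exact: closed_cpiece.
- by move=> y H h hs; apply: ltW; apply: H.
- by move=> y [[dy cy] ky]; apply: h1.
- rewrite E; apply: (@convex_connected _ _ x) => //.
  by apply: convexI; [exact: convex_disk r_ge0 | exact: convex_opiece].
- by split => //; apply: h2.
- by [].
Qed.

Lemma face_cases F : face C F ->
  [\/ F = disk o r `&` opiece halfP,
      exists i, F = disk o r `&` opiece (halfS i) |
      exists i, F = disk o r `&` opiece (halfC i)].
Proof.
move=> [x [dx cx] ->]; rewrite region_disk in dx.
case: (cover D x) => [h|[i h]|[i h]].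
- have ox : opiece halfP x by apply: separatedP.1 => //; apply/cpieceP.
  by apply: Or31; apply: piece_component => //; apply: separatedP.
- have ox : opiece (halfS i) x by apply: (separatedS i).1 => //; apply/cpieceS.
  by apply: Or32; exists i; apply: piece_component => //; apply: separatedS.
- have ox : opiece (halfC i) x by apply: (separatedC i).1 => //; apply/cpieceC.
  by apply: Or33; exists i; apply: piece_component => //; apply: separatedC.
Qed.

(** The end of a ray may lie on the boundary circle, so only the source is assumed interior; the
    open segment still lies in the open disk, which leaves room for a small displacement along
    [w]. *)
Lemma incident_piece s (k : dl_crease) w : separated_piece s ->
  open_disk o r (crease_src C k) -> disk o r (crease_dst C k) ->
  (forall x, open_segment (crease_src C k) (crease_dst C k) x ->
     forall h, h \in s -> 0 < dot h.1 (x - h.2) \/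
       (dot h.1 (x - h.2) = 0 /\ 0 < dot h.1 w)) ->
  incident C k w (disk o r `&` opiece s).
Proof.
move=> hs h1 h2 H.
have near x : open_segment (crease_src C k) (crease_dst C k) x ->
    \forall eps \near 0^'+, (disk o r `&` opiece s) (x + eps *: w).
  move=> hx; have d := open_segment_disk r_ge0 h1 h2 hx.
  have n1 := near_disk w r_ge0 d; have n2 := near_opiece (H x hx).
  by near=> eps; split; near: eps.
split => //.
(* A displaced midpoint of the crease is the base point that exhibits the piece as a connected
   component. *)
have hx : open_segment (crease_src C k) (crease_dst C k)
    (crease_src C k + 2^-1 *: (crease_dst C k - crease_src C k)).
  by exists 2^-1 => //=; rewrite in_itv /=; apply/andP; split; lra.
have /filter_ex [eps [dy oy]] := near _ hx.
exists (crease_src C k + 2^-1 *: (crease_dst C k - crease_src C k) + eps *: w).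
  by split; [rewrite region_disk | apply: hs.2].
by apply/esym/piece_component.
Unshelve. all: by end_near. Qed.

End Faces.

(** * Fold angles of the sides and of the rays *)

Section FoldAngles.
Variables (R : realType) (D : double_line R) (C : crease_pattern R dl_crease).
Variables (o : 'rV[R]_2) (r : R).
Implicit Types (i j k : 'I_4) (x y w : 'rV[R]_2) (a t : R) (b : bool).
Local Notation st := (sin (theta D)).
Local Notation sa i := (sin (angle D i)).
Local Notation n := (nrm D).
Local Notation c := (vtx D).
Local Notation l := (len D).
Local Notation e := (dir D).

Hypothesis region_disk : region C = disk o r.
Hypothesis vtx_open : forall i, open_disk o r (c i).
Hypothesis side_ends : forall i,
  crease_src C (side i) = c (i - 1) /\ crease_dst C (side i) = c i.
Hypothesis ray_segment : forall i (b : bool),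
  let base := if b then c i else c (i - 1) in
  crease_src C (ray i b) = base /\
  segment (crease_src C (ray i b)) (crease_dst C (ray i b)) =
    half_line base (e i) `&` disk o r.

Variables (m : 'I_4 -> bool) (T : 'I_4 -> R).
Hypothesis hm : forall i, mode_rel (m i) (theta D) (angle D i) (T i) (T (i + 1)).
Local Notation sigma := (fold_map D (wing D T)).
Local Notation FP := (disk o r `&` opiece (halfP D)).
Local Notation FS i := (disk o r `&` opiece (halfS D i)).
Local Notation FC i := (disk o r `&` opiece (halfC D i)).

Local Notation vS i := (embed (c (i - 1)) - c (i - 1) *m frameS D T i).
Local Notation vC i := (embed (c i) - c i *m frameC D T i).

Let sepP := separatedP side_ends ray_segment.
Let sepS := separatedS side_ends ray_segment.
Let sepC := separatedC side_ends ray_segment.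

Lemma opiece_cpiece s x : opiece s x -> cpiece s x.
Proof. by move=> H h hs; apply: ltW; apply: H. Qed.

Lemma congrP : congruent_on FP sigma 0 (frameP R).
Proof.
split; first exact: frameP_isometry.
by move=> x [_ /opiece_cpiece/cpieceP]; exact: congruentP.
Qed.

Lemma congrS i : congruent_on (FS i) sigma (vS i) (frameS D T i).
Proof.
split; first exact: frameS_isometry.
by move=> x [_ /opiece_cpiece/cpieceS]; exact: congruentS.
Qed.

Lemma congrC i : congruent_on (FC i) sigma (vC i) (frameC D T i).
Proof.
split; first exact: frameC_isometry hm i.
by move=> x [_ /opiece_cpiece/cpieceC]; exact: congruentC.
Qed.

Lemma rigid_fold_map d : 0 <= d -> 8 * fold_lip D * d <= 1 ->
  (forall i, `|wing D T i - embed (e i)| <= d) -> rigid_folded_state C sigma.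
Proof.
move=> d0 hd hT; split.
  by apply: near_isometry_homeo => x y; apply: fold_map_near hT.
move=> F /(face_cases region_disk vtx_open side_ends ray_segment).
case=> [->|[i ->]|[i ->]].
- by exists 0, (frameP R); exact: congrP.
- by eexists; eexists; exact: congrS.
- by eexists; eexists; exact: congrC.
Qed.

Definition fold_angle (k : dl_crease) (lam : R) :=
  is_fold_angle C sigma k (2 * atan lam).

Lemma atan_range (lam : R) : - pi < 2 * atan lam <= pi.
Proof.
have := atan_gtNpi2 lam; have := atan_ltpi2 lam => h1 h2.
by apply/andP; split; lra.
Qed.

Lemma side_vec i : crease_vec C (side i) = l i *: perp (n i).
Proof. by rewrite /crease_vec; have [-> ->] := side_ends i; rewrite side_eq. Qed.

(** A ray is specified only as a point set. Its end point belongs to that set, so it has the form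
    [base + a *: e i], and nondegeneracy of the crease excludes [a = 0]. *)
Lemma ray_vec i b : exists2 a, 0 < a & crease_vec C (ray i b) = a *: e i /\
  crease_dst C (ray i b) = base D i b + a *: e i /\
  disk o r (crease_dst C (ray i b)).
Proof.
have [E1 E2] := ray_segment i b.
have : segment (crease_src C (ray i b)) (crease_dst C (ray i b))
    (crease_dst C (ray i b)).
  by exists 1; [rewrite /= in_itv /= ler01 lexx | rewrite scale1r addrC subrK].
rewrite E2 => -[[a /=]]; rewrite in_itv /= andbT => a0 E3 hd.
have ne := crease_nondegenerate C (ray i b).
exists a; last first.
  by split; [rewrite /crease_vec E1 -E3 addrAC subrr add0r | split].
rewrite lt_neqAle a0 andbT; apply: contra ne => /eqP a0'.
by rewrite E1 -E3 -a0' scale0r addr0.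
Qed.

Lemma enormZ a (v : 'rV[R]_2) : 0 <= a -> dot v v = 1 -> enorm (a *: v) = a.
Proof. by move=> a0 hv; rewrite /enorm dotZr dotZl hv mulr1 -expr2 sqrtr_sqr ger0_norm. Qed.

Lemma unit_crease a (v : 'rV[R]_2) (B : 'M[R]_(2, 3)) : 0 < a -> dot v v = 1 ->
  (enorm (a *: v))^-1 *: ((a *: v) *m B) = v *m B.
Proof.
move=> a0 hv; rewrite enormZ ?ltW // -scalemxAl scalerA mulVf ?scale1r //.
by rewrite gt_eqF.
Qed.

Lemma perpZ a (v : 'rV[R]_2) : perp (a *: v) = a *: perp v.
Proof. by apply: row2P; rewrite !(coord2E, mxE) /=; rewrite ?mulrN. Qed.

Lemma perp_perp (v : 'rV[R]_2) : perp (perp v) = - v.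
Proof. by apply: row2P; rewrite !(coord2E, mxE) /=. Qed.

Lemma incident_side_left i :
  incident C (side i) (rotate (pi / 2) (crease_vec C (side i))) FP.
Proof.
have [E1 E2] := side_ends i.
apply: (incident_piece region_disk vtx_open) => //; rewrite ?E1 ?E2 //.
  by have := vtx_open i; apply: ltW.
rewrite rotate_pihalf side_vec perpZ perp_perp => x [t /=].
rewrite in_itv /= => /andP[t0 t1] <- h /mapP[j _ ->] /=; rewrite !dotNl.
rewrite -/(side_fun D j (sidept D i t)) N_sidept.
have t1' : 0 < 1 - t by rewrite subr_gt0.
have [->|ij] := eqVneq j i.
  right; rewrite N_vtx N_vtx_prev !mulr0 addr0 oppr0; split => //.
  by rewrite dotZr dotNr nrm_unit mulrN mulr1 opprK len_gt0.
left; rewrite oppr_gt0.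
(* At least one end of the side [i] is strictly inside the line of the side [j]: it is [c (i - 1)]
   when [j = i + 1], since [N j] then vanishes at [c i], and [c i] otherwise. *)
have [h1|h1] := eqVneq i (j - 1).
  rewrite {2}h1 N_vtx_prev mulr0 addr0 pmulr_rlt0 //; apply: vtx_convex.
    by rewrite h1; have [] := ord4_neq j; elim/ord4_ind: j {ij h1}.
  by rewrite h1; elim/ord4_ind: j {ij h1}.
have h2 : side_fun D j (c i) < 0 by apply: vtx_convex => //; rewrite eq_sym.
have h3 := inP_vtx D (i - 1) j.
by rewrite ltr_wnDl // ?pmulr_rle0 // pmulr_rlt0.
Qed.

Lemma incident_side_right i :
  incident C (side i) (rotate (- (pi / 2)) (crease_vec C (side i))) (FS i).
Proof.
have [E1 E2] := side_ends i; have l0 := len_gt0 D i; have s0 := st_gt0 D.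
apply: (incident_piece region_disk vtx_open) => //; rewrite ?E1 ?E2 //.
  by have := vtx_open i; apply: ltW.
rewrite rotate_Npihalf side_vec perpZ perp_perp scalerN opprK => x [t /=].
rewrite in_itv /= => /andP[t0 t1] <- h; rewrite -/(sidept D i t).
have N0 : side_fun D i (sidept D i t) = 0.
  by rewrite N_sidept N_vtx N_vtx_prev !mulr0 addr0.
have f0 : ray_fun0 D i (sidept D i t) = t * (l i * st).
  rewrite /ray_fun0 /sidept addrAC subrr add0r side_eq !crossZr.
  by rewrite cross_dir_perp.
have g0 : ray_fun1 D i (sidept D i t) = - ((1 - t) * (l i * st)).
  by have := fE D i (sidept D i t); rewrite f0 mulrBl mul1r => ->; ring.
rewrite !inE => /or3P[] /eqP -> /=.
- by right; split => //; rewrite dotZr nrm_unit mulr1.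
- by left; rewrite dot_perp_cross -/(ray_fun0 D i _) f0 !mulr_gt0.
- left; rewrite dotNl dot_perp_cross -/(ray_fun1 D i _) g0 opprK.
  by rewrite !mulr_gt0 // subr_gt0.
Qed.

Lemma fold_angle_side i : fold_angle (side i) (T i).
Proof.
split; first exact: atan_range.
exists FP, 0, (frameP R), (FS i), (vS i), (frameS D T i); split.
- by split; [exact: incident_side_left | exact: congrP].
- by split; [exact: incident_side_right | exact: congrS].
- by rewrite cos_2atan cos_side.
- rewrite sin_2atan side_vec unit_crease ?len_gt0 //; last first.
    by rewrite dot_perp_perp nrm_unit.
  by rewrite mul_frameP sin_side.
Qed.

Lemma open_ray i b x :
  open_segment (crease_src C (ray i b)) (crease_dst C (ray i b)) x ->
  exists2 a, 0 < a & x = base D i b + a *: e i.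
Proof.
have [a a0 [_ [E2 _]]] := ray_vec i b; have [E1 _] := ray_segment i b.
rewrite E2 E1 => -[t /=]; rewrite in_itv /= => /andP[t0 t1] <-.
exists (t * a); first by rewrite mulr_gt0.
by rewrite [X in _ *: X]addrAC subrr add0r scalerA.
Qed.

Lemma incident_ray i b w s : separated_piece C o r s ->
  (forall a, 0 < a -> forall h, h \in s ->
     0 < dot h.1 (base D i b + a *: e i - h.2) \/
     (dot h.1 (base D i b + a *: e i - h.2) = 0 /\ 0 < dot h.1 w)) ->
  incident C (ray i b) w (disk o r `&` opiece s).
Proof.
move=> hs H; have [E1 _] := ray_segment i b; have [a a0 [_ [_ hd]]] := ray_vec i b.
apply: (incident_piece region_disk vtx_open) => //.
  by rewrite E1; case: (b).
by move=> x /open_ray[a' a0' ->]; exact: H.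
Qed.

Lemma dot_perp_dir_perp i a : dot (perp (e i)) (a *: perp (e i)) = a.
Proof. by rewrite dotZr dot_perp_perp dot_dir mulr1. Qed.

Lemma incident_true_left i :
  incident C (ray i true) (rotate (pi / 2) (crease_vec C (ray i true))) (FC i).
Proof.
have [a a0 [-> _]] := ray_vec i true; have s0 := sa_gt0 D i.
rewrite rotate_pihalf perpZ; apply: incident_ray => // a' a0' h.
rewrite !inE => /orP[] /eqP -> /=; rewrite ?dotNl !dot_perp_cross.
- right; rewrite -/(ray_fun1 D i _) g_ray g_vtx; split => //.
  by rewrite -dot_perp_cross dot_perp_dir_perp.
- left; rewrite addrAC subrr add0r crossZr crossC cross_dir_next.
  by rewrite mulrN opprK mulr_gt0.
Qed.

Lemma incident_true_right i :
  incident C (ray i true) (rotate (- (pi / 2)) (crease_vec C (ray i true))) (FS i).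
Proof.
have [a a0 [-> _]] := ray_vec i true; have s0 := st_gt0 D.
rewrite rotate_Npihalf perpZ; apply: incident_ray => // a' a0' h.
rewrite !inE => /or3P[] /eqP -> /=; rewrite ?dotNl ?dot_perp_cross.
- by left; rewrite -/(side_fun D i _) N_ray N_vtx add0r mulr_gt0.
- left; rewrite -/(ray_fun0 D i _) f_ray fE g_vtx add0r.
  by rewrite mulr_gt0 ?len_gt0.
- right; rewrite -/(ray_fun1 D i _) g_ray g_vtx oppr0; split => //.
  by rewrite -dot_perp_cross dotNr dot_perp_dir_perp opprK.
Qed.

Lemma incident_false_left i :
  incident C (ray i false) (rotate (pi / 2) (crease_vec C (ray i false))) (FS i).
Proof.
have [a a0 [-> _]] := ray_vec i false; have s0 := st_gt0 D.
rewrite rotate_pihalf perpZ; apply: incident_ray => // a' a0' h.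
rewrite !inE => /or3P[] /eqP -> /=; rewrite ?dotNl ?dot_perp_cross.
- by left; rewrite -/(side_fun D i _) N_ray N_vtx_prev add0r mulr_gt0.
- right; rewrite -/(ray_fun0 D i _) f_ray f_vtx; split => //.
  by rewrite -dot_perp_cross dot_perp_dir_perp.
- left; rewrite -/(ray_fun1 D i _) g_ray.
  have := fE D i (c (i - 1)); rewrite f_vtx => /esym/eqP.
  by rewrite addr_eq0 => /eqP ->; rewrite opprK mulr_gt0 ?len_gt0.
Qed.

Lemma incident_false_right i :
  incident C (ray (i + 1) false)
    (rotate (- (pi / 2)) (crease_vec C (ray (i + 1) false))) (FC i).
Proof.
have [a a0 [-> _]] := ray_vec (i + 1) false; have s0 := sa_gt0 D i.
rewrite rotate_Npihalf perpZ; apply: incident_ray => // a' a0' h.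
rewrite !inE /= addrK => /orP[] /eqP -> /=; rewrite ?dotNl !dot_perp_cross.
- left; rewrite addrAC subrr add0r crossZr cross_dir_next.
  by rewrite mulr_gt0.
- right; rewrite addrAC subrr add0r crossZr crossxx mulr0 oppr0; split => //.
  by rewrite -dot_perp_cross dotNr dot_perp_dir_perp opprK.
Qed.

Lemma fold_angle_true i :
  fold_angle (ray i true) (if m i then - T (i + 1) else T (i + 1)).
Proof.
have [a a0 [E _]] := ray_vec i true.
split; first exact: atan_range.
exists (FC i), (vC i), (frameC D T i), (FS i), (vS i), (frameS D T i); split.
- by split; [exact: incident_true_left | exact: congrC].
- by split; [exact: incident_true_right | exact: congrS].
- by rewrite cos_2atan (cos_left_ray hm); case: (m i); rewrite ?coswN.
- rewrite sin_2atan E unit_crease ?dot_dir // mul_frame_l.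
    by rewrite (sin_left_ray hm).
  by rewrite cross_dir_next sa_neq0.
Qed.

(** The index is shifted because [ray (i + 1) false] is the second ray at [c i]; it lies opposite
    the side [i], whose fold angle it repeats up to sign. *)
Lemma fold_angle_false i :
  fold_angle (ray (i + 1) false) (if m i then T i else - T i).
Proof.
have [a a0 [E _]] := ray_vec (i + 1) false.
split; first exact: atan_range.
exists (FS (i + 1)), (vS (i + 1)), (frameS D T (i + 1)), (FC i), (vC i), (frameC D T i); split.
- by split; [exact: incident_false_left | exact: congrS].
- by split; [exact: incident_false_right | exact: congrC].
- by rewrite cos_2atan (cos_right_ray hm); case: (m i); rewrite ?coswN.
- rewrite sin_2atan E unit_crease ?dot_dir // mul_frame_l.
    by rewrite (sin_right_ray hm).
  by rewrite cross_dir_perp st_neq0.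
Qed.

End FoldAngles.

(** * Folding motions *)

Section Motion.
Variables (R : realType) (D : double_line R) (C : crease_pattern R dl_crease).
Variables (o : 'rV[R]_2) (r : R).
Local Notation c := (vtx D).
Local Notation e := (dir D).

Hypothesis region_disk : region C = disk o r.
Hypothesis vtx_open : forall i, open_disk o r (c i).
Hypothesis side_ends : forall i,
  crease_src C (side i) = c (i - 1) /\ crease_dst C (side i) = c i.
Hypothesis ray_segment : forall i (b : bool),
  let base := if b then c i else c (i - 1) in
  crease_src C (ray i b) = base /\
  segment (crease_src C (ray i b)) (crease_dst C (ray i b)) =
    half_line base (e i) `&` disk o r.

Variables (m : 4.-tuple bool) (kappa : 'I_4 -> R).
Hypothesis kappa_mode : forall i,
  mode_rel (tnth m i) (theta D) (angle D i) (kappa i) (kappa (i + 1)).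
Hypothesis kappa_neq0 : exists i, kappa i != 0.

(** Ratios of the half-angle tangents of all creases. Each ray copies the side opposite to it, with
    the sign of the mode at its own vertex; for [ray i false] that vertex is [c (i - 1)]. *)
Definition speed (k : dl_crease) : R :=
  match k with
  | inl i => kappa i
  | inr (i, true) => if tnth m i then - kappa (i + 1) else kappa (i + 1)
  | inr (i, false) => if tnth m (i - 1) then kappa (i - 1) else - kappa (i - 1)
  end.

(** The first factor dominates every [|kappa i|]. In the second, 32 is the 4 of [norm_wing] times
    the 8 of [fold_map_near], and the added 1 keeps the tangents of the sides at most 1, as
    [norm_wing] requires. *)
Definition step : R := ((1 + \sum_i `|kappa i|) * (1 + 32 * fold_lip D))^-1.

Definition motion (t : R) (k : dl_crease) : R := 2 * atan (speed k * (step * t)).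

Lemma sum_kappa_gt0 : 0 < 1 + \sum_i `|kappa i|.
Proof. by rewrite ltr_pwDl // sumr_ge0. Qed.

Lemma fold_lip32_gt0 : 0 < 1 + 32 * fold_lip D.
Proof. by rewrite ltr_pwDl // mulr_ge0 // ltW // fold_lip_gt0. Qed.

Lemma step_gt0 : 0 < step.
Proof. by rewrite invr_gt0 mulr_gt0 ?sum_kappa_gt0 ?fold_lip32_gt0. Qed.

Lemma kappa_small i t : 0 <= t <= 1 ->
  `|kappa i * (step * t)| <= (1 + 32 * fold_lip D)^-1.
Proof.
move=> /andP[t0 t1]; have s0 := step_gt0; have K0 := sum_kappa_gt0.
rewrite normrM (ger0_norm (mulr_ge0 (ltW s0) t0)).
have h : `|kappa i| <= 1 + \sum_j `|kappa j|.
  by rewrite (bigD1 i) //= addrCA lerDl addr_ge0 // sumr_ge0.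
apply: (@le_trans _ _ ((1 + \sum_j `|kappa j|) * step)).
  apply: ler_pM => //; first by rewrite mulr_ge0 // ltW.
  by rewrite ler_piMr // ltW.
by rewrite /step invfM mulrA divff ?mul1r // gt_eqF.
Qed.

Lemma mode_relZ s th a x y z :
  mode_rel s th a x y -> mode_rel s th a (x * z) (y * z :> R).
Proof. by rewrite /mode_rel; case: s => ->; rewrite mulrA. Qed.

Lemma motion_configuration t : t \in `[0, 1] -> configuration_space C (motion t).
Proof.
rewrite in_itv /= => ht; pose T i := kappa i * (step * t).
have hm i : mode_rel (tnth m i) (theta D) (angle D i) (T i) (T (i + 1)).
  exact/mode_relZ/kappa_mode.
have L0 := fold_lip_gt0 D; have K0 := fold_lip32_gt0.
have K1 : (1 + 32 * fold_lip D)^-1 <= 1.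
  by rewrite invf_le1 // lerDl mulr_ge0 // ltW.
exists (fold_map D (wing D T)); split.
  apply: (rigid_fold_map region_disk vtx_open side_ends ray_segment hm
    (d := 4 * (1 + 32 * fold_lip D)^-1)).
  - by rewrite mulr_ge0 // invr_ge0 ltW.
  - rewrite mulrA ler_pdivrMr // mul1r.
    by rewrite (_ : 8 * _ * 4 = 32 * fold_lip D) ?lerDr //; ring.
  - move=> i; have h := kappa_small i ht; apply: le_trans (norm_wing _ _) _.
      exact: le_trans h K1.
    by rewrite ler_wpM2l.
case=> [i|[i []]]; rewrite /motion /=.
- by have := fold_angle_side region_disk vtx_open side_ends ray_segment T i.
- have := fold_angle_true region_disk vtx_open side_ends ray_segment hm i.
  by rewrite /fold_angle /T; case: (tnth m i); rewrite ?mulNr.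
- have := fold_angle_false region_disk vtx_open side_ends ray_segment hm (i - 1).
  by rewrite /fold_angle /T subrK; case: (tnth m (i - 1)); rewrite ?mulNr.
Qed.

Lemma motion_continuous k : continuous (fun t => motion t k).
Proof.
move=> t; rewrite /motion.
apply: (@continuousM _ _ (fun=> 2) (fun t => atan (speed k * (step * t)))).
  exact: cst_continuous.
apply: (@continuous_comp _ _ _ (fun t => speed k * (step * t)) (@atan R)).
  apply: (@continuousM _ _ (fun=> speed k) (fun t => step * t)).
    exact: cst_continuous.
  by apply: (@continuousM _ _ (fun=> step) id); [exact: cst_continuous | exact: cvg_id].
exact: continuous_atan.
Qed.

Lemma tan_motion t k : tan (motion t k / 2) = speed k * (step * t).
Proof. by rewrite /motion [2 * _]mulrC mulfK ?pnatr_eq0 // atanK. Qed.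

Lemma motion_mode t i :
  vertex_in_mode (theta D) (angle D) i (tnth m i) (motion t).
Proof.
rewrite /vertex_in_mode /= !tan_motion /= addrK.
have := kappa_mode i; rewrite /mode_rel; case: (tnth m i) => h.
  by exists (kappa i * (step * t)); rewrite /= h mul1r !mulNr !mulrA.
by exists (kappa (i + 1) * (step * t)); rewrite /= h mul1r !mulNr opprK !mulrA.
Qed.

Lemma motion_rigid : [/\ rigid_folding_motion C motion, from_flat motion & nonconstant motion].
Proof.
split.
- split; first exact: motion_configuration.
  by move=> k; apply: continuous_subspaceT; exact: motion_continuous.
- by move=> k; rewrite /motion !mulr0 atan0 mulr0.
- have [i ki] := kappa_neq0; exists 0, 1; split; rewrite ?in_itv /= ?lexx ?ler01 //.
  move=> h; have := tan_motion 0 (side i); rewrite h tan_motion !mulr0 mulr1 /=.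
  by move/eqP; rewrite mulf_eq0 (negbTE ki) gt_eqF // step_gt0.
Qed.

Lemma motion_folding_mode : folding_mode (theta D) (angle D) C m.
Proof.
have [h1 h2 h3] := motion_rigid; exists motion; split => // t _ i.
exact: motion_mode.
Qed.

End Motion.

(** * Speeds of the four modes *)

Section Theorem1.
Variable R : realType.
Implicit Types (x y t : R).

Lemma rotateD x y (v : 'rV[R]_2) : rotate x (rotate y v) = rotate (x + y) v.
Proof. by apply: row2P; rewrite !coord2E cosD sinD; ring. Qed.

Lemma tan_half_compl x : 0 < x < pi -> tan ((pi - x) / 2) = (tan (x / 2))^-1.
Proof.
move=> hx; have -> : (pi - x) / 2 = pi / 2 - x / 2 by field.
by rewrite /tan sinB cosB sin_pihalf cos_pihalf !mul0r !mul1r subr0 add0r invf_div.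
Qed.

Lemma pcoef_compl t x : 0 < t < pi -> 0 < x < pi ->
  pcoef t (pi - x) = qcoef t x.
Proof.
move=> ht hx; rewrite /pcoef /qcoef tan_half_compl //.
have := tan_half_gt0 hx; have := tan_half_gt0 ht.
set u := tan (t / 2); set v := tan (x / 2) => u0 v0.
by field; rewrite !gt_eqF // addr_gt0.
Qed.

Lemma qcoef_compl t x : 0 < t < pi -> 0 < x < pi ->
  qcoef t (pi - x) = pcoef t x.
Proof.
move=> ht hx; rewrite -[in RHS](subKr pi x) pcoef_compl //.
by move: hx => /andP[h1 h2]; apply/andP; split; lra.
Qed.

(* Each list solves the four relations of its mode because
   [pcoef t (pi - x) = qcoef t x], which makes the products around P agree. *)
Definition mode_speeds (pa pb qa qb : R) (m : 4.-tuple bool) : 'I_4 -> R :=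
  fun i => nth 0
    (if m == mode_aI then [:: - pa; 1; qb; pa * qb]
     else if m == mode_aII then [:: pb; qa * pb; - qa; 1]
     else if m == mode_bI then [:: 1; qa; qa * qb; - qb]
     else [:: pa * pb; - pb; 1; pa]) i.

Lemma mode_speeds_rel (alpha beta th : R) m :
  0 < alpha < pi -> 0 < beta < pi -> 0 < th < pi ->
  m \in [:: mode_aI; mode_aII; mode_bI; mode_bII] ->
  let kappa := mode_speeds (pcoef th alpha) (pcoef th beta)
                 (qcoef th alpha) (qcoef th beta) m in
  (exists i, kappa i != 0) /\
  forall i, mode_rel (tnth m i) th (sector_angles alpha beta i)
              (kappa i) (kappa (i + 1)).
Proof.
move=> ha hb ht hm kappa.
have E i : mode_rel (tnth m i) th (sector_angles alpha beta i) (kappa i) (kappa (i + 1)).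
  move: hm; rewrite /kappa !inE => /or4P[] /eqP ->; elim/ord4_ind: i;
    rewrite /mode_rel /mode_speeds /sector_angles /tnth /= ?pcoef_compl ?qcoef_compl //; ring.
split => //; move: hm; rewrite /kappa !inE => /or4P[] /eqP ->.
- by exists 1; rewrite /mode_speeds /= oner_neq0.
- by exists 3; rewrite /mode_speeds /= oner_neq0.
- by exists 0; rewrite /mode_speeds /= oner_neq0.
- by exists 2; rewrite /mode_speeds /= oner_neq0.
Qed.

Lemma sector_range (alpha beta : R) i : 0 < alpha < pi -> 0 < beta < pi ->
  0 < sector_angles alpha beta i < pi.
Proof.
move=> /andP[a0 a1] /andP[b0 b1].
by elim/ord4_ind: i; rewrite /sector_angles /=; apply/andP; split; lra.
Qed.

End Theorem1.

Theorem theorem1 (R : realType) (alpha beta theta : R)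
    (e : 'I_4 -> 'rV[R]_2) (C : crease_pattern R dl_crease)
    (halpha : 0 < alpha < pi) (hbeta : 0 < beta < pi) (htheta : 0 < theta < pi)
    (hV : flat_foldable_vertex (sector_angles alpha beta) e)
    (hDL : is_double_line e theta C) :
  (exists gamma : R -> dl_crease -> R,
     [/\ rigid_folding_motion C gamma, from_flat gamma & nonconstant gamma]) /\
  (uniq [:: mode_aI; mode_aII; mode_bI; mode_bII] /\
   forall m, m \in [:: mode_aI; mode_aII; mode_bI; mode_bII] ->
     folding_mode theta (sector_angles alpha beta) C m).
Proof.
have [[_ _ e_unit e_next] _] := hV.
have [c [ctr [r [[conv sides] quad reg side_ends rays]]]] := hDL.
(* The side has the direction of [e i] turned by [pi - theta]; a quarter turn back gives its outward
   normal. *)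
pose n i := rotate (pi / 2 - theta) (e i).
have perp_n i : perp (n i) = rotate (pi - theta) (e i).
  rewrite -rotate_pihalf /n rotateD; congr (rotate _ _).
  by rewrite addrA -splitr.
pose len i := s2val (cid2 (sides i)).
have len_gt0 i : 0 < len i := s2valP (cid2 (sides i)).
have side_eq i : c i - c (i - 1) = len i *: perp (n i).
  by rewrite perp_n; exact: s2valP' (cid2 (sides i)).
have n_unit i : dot (n i) (n i) = 1.
  have := enorm_sqr (e i); rewrite e_unit expr1n => h.
  rewrite -[RHS]mulr1 [X in X * _]h -(cos2Dsin2 (pi / 2 - theta)).
  by rewrite !dot2E !coord2E; ring.
have n_next i : n (i + 1) = rotate (sector_angles alpha beta i) (n i).
  by rewrite /n e_next !rotateD addrC.
have convex i j : j != i - 1 -> j != i -> dot (n i) (c j - c i) < 0.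
  move=> h1 h2; have := conv i j h1 h2; rewrite side_eq.
  rewrite -(pmulr_rlt0 _ (len_gt0 i)) -oppr_lt0; congr (_ < 0).
  have -> : c (i - 1) = c i - len i *: perp (n i) by rewrite -side_eq subKr.
  by rewrite dot2E /cross2 !(coord2E, mxE) /=; ring.
pose D := DoubleLine htheta (fun i => sector_range i halpha hbeta) n_unit
  n_next len_gt0 side_eq convex.
have dirE i : dir D i = e i.
  have cs := cos2Dsin2 theta.
  apply: row2P; rewrite /dir /= /n !(coord2E, mxE) /= !(cosB, sinB) sin_pihalf cos_pihalf.
    by transitivity ((cos theta ^+ 2 + sin theta ^+ 2) * e i 0 0);
      [ring | rewrite cs mul1r].
  by transitivity ((cos theta ^+ 2 + sin theta ^+ 2) * e i 0 1);
    [ring | rewrite cs mul1r].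
have c_open i : open_disk ctr r (c i).
  (* A vertex is the convex combination with all the weight on itself. *)
  apply: quad; exists (fun j => (j == i)%:R); split => [j||].
  - by rewrite ler0n.
  - by rewrite (bigD1 i) //= eqxx big1 ?addr0 // => j /negbTE ->.
  - rewrite (bigD1 i) //= eqxx scale1r big1 ?addr0 // => j /negbTE ->.
    by rewrite scale0r.
have modes m : m \in [:: mode_aI; mode_aII; mode_bI; mode_bII] ->
    folding_mode theta (sector_angles alpha beta) C m.
  move=> /(mode_speeds_rel halpha hbeta htheta)[k0 kr].
  apply: (@motion_folding_mode R D C ctr r reg c_open side_ends _ m _ kr k0).
  by move=> i b; rewrite dirE; exact: rays.
split; last by split.
have [gamma [h1 h2 h3 _]] := modes mode_aI (mem_head _ _).
by exists gamma.
Qed.
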